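(* Let $\lambda>0$ and let $N^\Gamma(t)$, $t\ge0$, be the gamma-Poisson process (defined in the context). Let $k\ge1$, $1\le r\le k$, and let $l_1,\dots,l_r\ge1$ be integers with $\sum_{j=1}^r l_j=k$. Let $\tau_j^{l_j}$ denote the instant of the $j$-th jump in $[0,t]$, this jump having height $l_j$, where $r$ is the number of jumps in $[0,t]$. Then, on the simplex $0<t_1<t_2<\dots<t_r<t$, $$\Pr\Bigl\{\bigcap_{j=1}^r\{\tau_j^{l_j}\in dt_j\}\,\Big|\,N^\Gamma(t)=k\Bigr\}=\frac{k!\,\Gamma(t)}{\Gamma(t+k)}\prod_{j=1}^r\frac{dt_j}{l_j}.$$
   Context: The gamma-Poisson process $N^\Gamma$ is the non-negative integer-valued process with $N^\Gamma(0)=0$, non-decreasing right-continuous paths, and independent and stationary increments, such that as $dt\downarrow0$, with $N^\Gamma[t,t+dt)$ the increment over $[t,t+dt)$, $$\Pr\{N^\Gamma[t,t+dt)=k\}=\begin{cases} dt\,\dfrac{\lambda^k}{k!}\displaystyle\int_0^\infty e^{-\lambda s}s^k\,\nu(ds)+o(dt), & k\ge 1,\\[2mm] 1-dt\displaystyle\int_0^\infty(1-e^{-\lambda s})\,\nu(ds)+o(dt), & k=0,\end{cases}\qquad \nu(ds)=\frac{e^{-s}}{s}\,ds.$$ For each $t$, $N^\Gamma(t)$ has the same law as $N(H^\Gamma(t))$, where $N$ is a homogeneous Poisson process of rate $\lambda$ and $H^\Gamma$ is an independent gamma subordinator, $\mathbb{E}e^{-\mu H^\Gamma(t)}=(1+\mu)^{-t}$.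 The displayed identity means: for every Borel subset $A$ of $\{0<t_1<\dots<t_r<t\}$, the conditional probability given $N^\Gamma(t)=k$ that there are exactly $r$ jumps in $[0,t]$, with successive heights $l_1,\dots,l_r$ and successive times $(\tau_1,\dots,\tau_r)\in A$, is the integral over $A$ of the stated density with respect to $dt_1\cdots dt_r$. *)

(* Defs.v *)
From HB Require Import structures.
From mathcomp Require Import all_boot all_order all_algebra.
From mathcomp Require Import all_classical all_reals all_analysis.

Set Implicit Arguments.
Unset Strict Implicit.
Unset Printing Implicit Defensive.

Import Order.TTheory GRing.Theory Num.Theory.
Import numFieldNormedType.Exports.

Local Open Scope classical_set_scope.
Local Open Scope ring_scope.

(** * Lebesgue measure on [n.-tuple R] *)

Section tuple_cons_measure.
Context {R : realType} (n : nat).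
Variable m : {sigma_finite_measure set (n.-tuple R) -> \bar R}.

Let consf (p : R * n.-tuple R) : n.+1.-tuple R := cons_tuple p.1 p.2.

Let measurable_consf : measurable_fun setT consf.
Proof. exact: measurable_cons measurable_fst measurable_snd. Qed.

(** The product of one-dimensional Lebesgue measure with [m], transported along
    the isomorphism R * R^n = R^(n+1). *)
Definition lebesgue_cons : set (n.+1.-tuple R) -> \bar R :=
  pushforward (lebesgue_measure \x m)%E consf.

Let lebesgue_cons0 : lebesgue_cons set0 = 0%E.
Proof. by rewrite /lebesgue_cons /pushforward preimage_set0 measure0. Qed.

Let lebesgue_cons_ge0 A : (0 <= lebesgue_cons A)%E.
Proof. exact: measure_ge0. Qed.

Let lebesgue_cons_sigma_additive : semi_sigma_additive lebesgue_cons.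
Proof.
move=> F mF tF mUF; rewrite /lebesgue_cons /pushforward preimage_bigcup.
apply: measure_semi_sigma_additive.
- by move=> i; rewrite -[X in measurable X]setTI; exact: measurable_consf.
- apply/trivIsetP => /= i j _ _ ij; rewrite -preimage_setI.
  by move/trivIsetP : tF => /(_ _ _ _ _ ij) ->//; rewrite preimage_set0.
- by rewrite -preimage_bigcup -[X in measurable X]setTI; exact: measurable_consf.
Qed.

HB.instance Definition _ := isMeasure.Build _ _ _ lebesgue_cons
  lebesgue_cons0 lebesgue_cons_ge0 lebesgue_cons_sigma_additive.

Let lebesgue_cons_sigma_finite : sigma_finite setT lebesgue_cons.
Proof.
have /sigma_finiteP[F [TF ndF Foo]] := sigma_finiteT (@lebesgue_measure R).
have /sigma_finiteP[G [TG ndG Goo]] := sigma_finiteT m.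
exists (fun i => (@thead n R) @^-1` F i `&`
                 (fun x : n.+1.-tuple R => [tuple of behead x]) @^-1` G i).
  apply/esym; rewrite -subTset => x _.
  have [i _ Fi] : (\bigcup_i F i) (thead x) by rewrite -TF.
  have [j _ Gj] : (\bigcup_i G i) [tuple of behead x] by rewrite -TG.
  exists (maxn i j) => //; split.
    by have /subsetPset := ndF _ _ (leq_maxl i j); exact.
  by have /subsetPset := ndG _ _ (leq_maxr i j); exact.
move=> i; have [mF Fi] := Foo i; have [mG Gi] := Goo i; split.
  apply: measurableI; rewrite -[X in measurable X]setTI.
    exact: (@measurable_tnth _ R).
  exact: measurable_behead.
rewrite /lebesgue_cons /pushforward (_ : _ @^-1` _ = F i `*` G i).
  by rewrite product_measure1E// lte_mul_pinfty// ge0_fin_numE.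
apply/seteqP; split => -[a x] /=; rewrite theadE;
  by rewrite (_ : [tuple of behead (cons_tuple a x)] = x)//; exact/val_inj.
Qed.

HB.instance Definition _ := Measure_isSigmaFinite.Build _ _ _ lebesgue_cons
  lebesgue_cons_sigma_finite.

End tuple_cons_measure.

Fixpoint lebesgue_tuple (R : realType) (n : nat) :
    {sigma_finite_measure set (n.-tuple R) -> \bar R} :=
  match n with
  | 0 => \d_([tuple] : 0.-tuple R)
  | n'.+1 => lebesgue_cons (lebesgue_tuple R n')
  end.

(** Normalisation check: boxes have the expected volume. *)
Lemma lebesgue_tuple_box (R : realType) (n : nat) (B : 'I_n -> set R) :
  (forall i, measurable (B i)) ->
  lebesgue_tuple R n [set x | forall i, B i (tnth x i)] =
  (\prod_(i < n) (lebesgue_measure : set R -> \bar R) (B i))%E.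
Proof.
elim: n B => [|n IHn] B mB.
  rewrite big_ord0 /= diracE mem_set//= => i; by case: i.
rewrite big_ord_recl /= /lebesgue_cons /pushforward.
rewrite [X in (_ \x _)%E X](_ : _ = B ord0 `*`
    [set x : n.-tuple R | forall i, B (lift ord0 i) (tnth x i)]); last first.
  apply/seteqP; split => -[a x] /=.
    move=> H; split; first by have := H ord0.
    by move=> i; have := H (lift ord0 i); rewrite tnthS; congr (B _ _);
      rewrite !(tnth_nth a).
  move=> [Ba Bx] i; case: (unliftP ord0 i) => [j ->|->] //.
  by have := Bx j; rewrite !(tnth_nth a).
rewrite product_measure1E//; last first.
  rewrite (_ : [set x | _] = \bigcap_(i in [set: 'I_n])
    ((fun x : n.-tuple R => tnth x i) @^-1` B (lift ord0 i))); last first.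
    by apply/seteqP; split => x /= H i; [move=> _|]; exact: H.
  apply: fin_bigcap_measurable; first exact: finite_finset.
  move=> i _; rewrite -[X in measurable X]setTI.
  exact: measurable_tnth.
  exact: mB.
by congr (_ * _)%E; apply: (IHn (fun i => B (lift ord0 i))) => i; exact: mB.
Qed.

(** * Special functions and elementary probability *)

Definition Gamma (R : realType) (x : R) : R :=
  \int[lebesgue_measure]_(s in `]0, +oo[) (s `^ (x - 1) * expR (- s)).

Definition cond_prob d (T : measurableType d) (R : realType)
    (P : probability T R) (E F : set T) : R :=
  fine (P (E `&` F)) / fine (P F).

Definition independent_family d d' (T : measurableType d)
    (T' : measurableType d') (R : realType) (P : probability T R)
    (I : finType) (X : I -> T -> T') : Prop :=
  forall (J : {set I}) (B : I -> set T'), (forall i, measurable (B i)) ->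
    P (\bigcap_(i in [set` J]) (X i @^-1` B i)) =
    (\prod_(i in J) P (X i @^-1` B i))%E.

(** * The gamma-Poisson process *)

Section gamma_poisson.
Context d (T : measurableType d) (R : realType).

(** Density of the Levy measure of the gamma subordinator, on ]0, +oo[. *)
Definition levy_density (s : R) : R := expR (- s) / s.

Definition jump_intensity (lambda : R) (k : nat) : R :=
  lambda ^+ k / k`!%:R *
  \int[lebesgue_measure]_(s in `]0, +oo[)
    (expR (- (lambda * s)) * s ^+ k * levy_density s).

Definition total_intensity (lambda : R) : R :=
  \int[lebesgue_measure]_(s in `]0, +oo[)
    ((1 - expR (- (lambda * s))) * levy_density s).

Context (P : probability T R).

(** Only the times [t >= 0] of a process [N] are meaningful; the subtraction is
    not truncated when [s <= t] and [N] is non-decreasing. *)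
Definition increment (N : R -> {RV P >-> nat}) (s t : R) (w : T) : nat :=
  (N t w - N s w)%N.

Record gamma_poisson_process (lambda : R) (N : R -> {RV P >-> nat}) : Prop := {
  gp_start : forall w, N 0 w = 0%N ;
  gp_nondecreasing : forall w (s t : R), 0 <= s -> s <= t -> (N s w <= N t w)%N ;
  gp_right_continuous : forall w (t : R), 0 <= t ->
    N u w @[u --> t^'+] --> N t w ;
  gp_independent_increments : forall (n : nat) (s : nat -> R),
    0 <= s 0%N -> (forall i, s i <= s i.+1) ->
    independent_family P (fun i : 'I_n => increment N (s i) (s i.+1)) ;
  gp_stationary_increments : forall (s t h : R) (B : set nat),
    0 <= s -> 0 <= t -> 0 <= h ->
    P (increment N s (s + h) @^-1` B) = P (increment N t (t + h) @^-1` B) ;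
  gp_jump : forall (t : R) (k : nat), 0 <= t -> (1 <= k)%N -> forall h : R,
    fine (P (increment N t (t + h) @^-1` [set k])) =
    h * jump_intensity lambda k +o_(h \near 0^'+) h ;
  gp_no_jump : forall t : R, 0 <= t -> forall h : R,
    fine (P (increment N t (t + h) @^-1` [set 0%N])) =
    1 - h * total_intensity lambda +o_(h \near 0^'+) h
}.

(** * Jumps of a path *)

Definition jump_height (f : R -> nat) (s : R) : nat :=
  (f s - lim (f u @[u --> s^'-]))%N.

(** Time 0 is never a jump time, the left limit being taken to be [f 0]. *)
Definition jump_times (f : R -> nat) (t : R) : set R :=
  [set s | 0 < s <= t /\ jump_height f s != 0%N].

(** The path has exactly [r] jumps in [[0, t]], of successive heights
    [l 0, ..., l (r - 1)], and the tuple of successive jump times lies in [A]. *)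
Definition jumps_event (N : R -> {RV P >-> nat}) (t : R) (r : nat)
    (l : 'I_r -> nat)
    (A : set (r.-tuple R)) : set T :=
  [set w | exists tau : r.-tuple R,
     [/\ sorted <%R tau,
         jump_times (fun u => N u w) t = [set` tau],
         forall j, jump_height (fun u => N u w) (tnth tau j) = l j
       & A tau]].

End gamma_poisson.

(** The set 0 < x_1 < ... < x_r < t. *)
Definition open_simplex (R : realType) (r : nat) (t : R) : set (r.-tuple R) :=
  [set x : r.-tuple R | path <%R 0 (rcons x t)].
Arguments open_simplex {R} r t.

(* Main.v *)
Require Import Defs.
From mathcomp Require Import all_boot all_order all_algebra.
From mathcomp Require Import all_classical all_reals all_analysis.
From mathcomp Require Import measurable_realfun ring lra.

Set Implicit Arguments.
Unset Strict Implicit.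
Unset Printing Implicit Defensive.

Import Order.TTheory GRing.Theory Num.Theory.
Import numFieldNormedType.Exports.

Local Open Scope classical_set_scope.
Local Open Scope ring_scope.

(** The process jumps by [l] at rate [x ^ l / l], where
    [x = lambda / (1 + lambda)], and stays put for a time [h] with probability
    [exp (- theta * h)], where [theta] is the total intensity. Hence jumps of
    heights [l_1, ..., l_r], summing to [k], occur at times in [dt_1, ..., dt_r]
    (and nothing else happens up to time [t]) with density
    [exp (- theta * t) * x ^ k * \prod_j (1 / l_j)], which does not depend on the
    times. On the other hand [N t] takes the value [k] with probability
    [exp (- theta * t) * x ^ k * t (t + 1) ... (t + k - 1) / k!]. In the quotient
    the first two factors cancel, and [t (t + 1) ... (t + k - 1)] is
    [Gamma (t + k) / Gamma t] by the functional equation of [Gamma].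

    The law of [N t] ([marginalE]) is obtained without a differential equation.
    It is a convolution semigroup in [t], by independence and stationarity of
    the increments; so is the claimed law, by Vandermonde's identity for rising
    factorials ([rising_coefD]); and both have the same expansion to first order
    at [0]. By induction on [k], their difference is then subadditive and of
    order [o(h)], hence zero ([subadditive_littleo_eq0]).

    For the density, a path has its jumps at the coordinates of [x], with heights
    [l_j], exactly when it coincides on [[0, t]] with the corresponding step
    function ([jumps_stepP]). When [x] ranges over a box whose sides are
    successive disjoint intervals, this event is the decreasing limit, along
    dyadic subdivisions of the sides, of events that only involve finitely many
    increments ([grid_crosses_step], [probability_crosses]); the limit of their
    probabilities is the density times the volume of the box
    ([probability_step_box]). Such boxes form a pi-system which generates the
    Borel subsets of the simplex, and the jump times are measurable functions of
    the path, being passage times; so the two measures agree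
    ([probability_step_event]). *)
(** * The Gamma function *)

Section gamma_integral.
Context {R : realType}.
Notation mu := (@lebesgue_measure R).
Implicit Types c t : R.

Definition gamma_kernel c t : R -> R := fun s => s `^ (t - 1) * expR (- (c * s)).

(** With [c = 1] this is [Gamma t]; with [c = 1 + lambda] and [t = l] it gives the
    intensity of the jumps of height [l]. It is kept in the extended reals, so that
    the recursion below can be used to prove that it is finite. *)
Definition gamma_integral c t : \bar R :=
  (\int[mu]_(s in `]0%R, +oo[) (gamma_kernel c t s)%:E)%E.

Lemma gamma_kernel_ge0 c t s : 0 <= gamma_kernel c t s.
Proof. by rewrite mulr_ge0 ?powR_ge0 ?expR_ge0. Qed.

Lemma is_derive_expRM c (s : R) :
  is_derive s 1 (fun u => - expR (- (c * u))) (c * expR (- (c * s))).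
Proof.
apply: is_derive_eq.
by rewrite mulrN opprK mulrC /GRing.scale/= mulr1.
Qed.

Lemma derivable_gamma_kernel c t s : 0 < s -> derivable (gamma_kernel c t) s 1.
Proof.
move=> s0; apply: derivableM.
  by apply: derivable_powR; rewrite in_itv/= s0.
by have [+ _] := is_derive_expRM c s => /derivableN; rewrite opprK.
Qed.

Lemma measurable_gamma_kernel c t :
  measurable_fun (`]0%R, +oo[ : set R) (gamma_kernel c t).
Proof.
apply: open_continuous_measurable_fun => // s.
rewrite inE/= in_itv/= andbT => s0.
by apply: differentiable_continuous; apply/derivable1_diffP; exact: derivable_gamma_kernel.
Qed.

Let A n : set R := `[n.+2%:R^-1, n.+2%:R].

Let A_pos n (s : R) : A n s -> 0 < s.
Proof. by rewrite /A/= in_itv/= => /andP[+ _]; apply: lt_le_trans; rewrite invr_gt0. Qed.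

Let mA n : measurable (A n).
Proof. exact: measurable_itv. Qed.

Let bigcupA : \bigcup_n A n = `]0, +oo[%classic.
Proof.
apply/seteqP; split => [s [n _ /A_pos]|s]; rewrite /= in_itv/= andbT// => s0.
have [n sn] : exists n, s + s^-1 < n%:R.
  by exists (Num.truncn (s + s^-1)).+1; exact: truncnS_gt.
exists n => //; rewrite /A/= in_itv/=.
have si0 : 0 < s^-1 by rewrite invr_gt0.
have n2 : n%:R <= n.+2%:R :> R by rewrite ler_nat -addn2 leq_addr.
apply/andP; split; last by rewrite (le_trans _ n2)// ltW// (le_lt_trans _ sn)// lerDl ltW.
by rewrite invf_ple ?posrE// (le_trans _ n2)// ltW// (le_lt_trans _ sn)// lerDr ltW.
Qed.

Let ndA : nondecreasing_seq A.
Proof.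
move=> m n mn; apply/subsetPset => s; rewrite /A/= !in_itv/= => /andP[s1 s2].
apply/andP; split; last by rewrite (le_trans s2)// ler_nat.
by rewrite (le_trans _ s1)// lef_pV2 ?posrE// ler_nat.
Qed.

Let gamma_integral_cvg c t :
  (\int[mu]_(s in A n) (gamma_kernel c t s)%:E)%E @[n --> \oo] --> gamma_integral c t.
Proof.
rewrite /gamma_integral -bigcupA.
apply: ge0_nondecreasing_set_cvg_integral => //.
- move=> n; apply/measurable_EFinP.
  apply: measurable_funS (measurable_gamma_kernel c t) => //.
  by move=> s /A_pos; rewrite /= in_itv/= andbT.
- by move=> n s _; rewrite lee_fin gamma_kernel_ge0.
Qed.

(* The boundary terms of the integration by parts: powers dominate at 0, and
   exponentials at infinity through exp (c n) >= (c n) ^ m.+1 / m.+1! *)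
Let boundary_cvg c t : 0 < c -> 0 < t ->
  gamma_kernel c (t + 1) n.+2%:R^-1 - gamma_kernel c (t + 1) n.+2%:R
  @[n --> \oo] --> (0 : R).
Proof.
move=> c0 t0; rewrite -[X in _ --> X]subr0; apply: cvgB.
  apply: (@squeeze_cvgr _ _ _ _ (fun=> 0) (fun n : nat => (n.+2%:R^-1 : R) `^ t)).
  - near=> n; rewrite gamma_kernel_ge0/= /gamma_kernel addrK ler_piMr ?powR_ge0//.
    by rewrite -expR0 ler_expR oppr_le0 mulr_ge0// ltW.
  - exact: cvg_cst.
  - have /cvg_at_rightP := powR_cvg0 t0; apply; split.
      by move=> n; rewrite invr_gt0.
    by have := @cvg_harmonic R; rewrite -cvg_shiftS.
pose m := (Num.truncn t).+1.
have tm : t <= m%:R.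
  exact/ltW/truncnS_gt.
pose K := m.+1`!%:R / c ^+ m.+1.
apply: (@squeeze_cvgr _ _ _ _ (fun=> 0) (fun n : nat => K * n.+2%:R^-1)).
- near=> n; rewrite gamma_kernel_ge0/= /gamma_kernel addrK.
  have cn0 : 0 <= c * n.+2%:R by rewrite mulr_ge0// ltW.
  have h1 : n.+2%:R `^ t <= n.+2%:R ^+ m :> R.
    by rewrite -powR_mulrn// ler_powR// ler1n.
  have h2 : (c * n.+2%:R) ^+ m.+1 / m.+1`!%:R <= expR (c * n.+2%:R) :> R.
    by rewrite (le_trans _ (expR_ge1Dxn m cn0))// lerDr.
  rewrite expRN ler_pdivrMr ?expR_gt0//.
  apply: (le_trans h1); apply: (@le_trans _ _
    (K / n.+2%:R * ((c * n.+2%:R) ^+ m.+1 / m.+1`!%:R))); last first.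
    by rewrite ler_wpM2l// !mulr_ge0 ?invr_ge0 ?exprn_ge0// ltW.
  have f0 : m.+1`!%:R != 0 :> R by rewrite pnatr_eq0 -lt0n fact_gt0.
  have cm0 : c ^+ m.+1 != 0 by rewrite expf_neq0// gt_eqF.
  have n0 : n.+2%:R != 0 :> R by rewrite pnatr_eq0.
  rewrite /K exprMn (exprS n.+2%:R m) le_eqVlt; apply/orP; left; apply/eqP.
  move: f0 cm0 n0; move: (m.+1`!%:R) (c ^+ m.+1) (n.+2%:R) => x y z x0 y0 z0.
  by field; rewrite x0 y0 z0.
- exact: cvg_cst.
- rewrite -(mulr0 K); apply: cvgM; first exact: cvg_cst.
  by have := @cvg_harmonic R; rewrite -cvg_shiftS.
Unshelve. all: by end_near. Qed.

Let by_parts c t n : 0 < c -> 0 < t ->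
  (c%:E * \int[mu]_(s in A n) (gamma_kernel c (t + 1) s)%:E =
   (gamma_kernel c (t + 1) n.+2%:R^-1 - gamma_kernel c (t + 1) n.+2%:R)%:E +
   t%:E * \int[mu]_(s in A n) (gamma_kernel c t s)%:E)%E.
Proof.
move=> c0 t0.
have mk u : measurable_fun (A n) (fun s => (gamma_kernel c u s)%:E).
  apply/measurable_EFinP; apply: measurable_funS (measurable_gamma_kernel c u) => //.
  by move=> s /A_pos; rewrite /= in_itv/= andbT.
have k0 u : forall s, A n s -> (0 <= (gamma_kernel c u s)%:E)%E.
  by move=> s _; rewrite lee_fin gamma_kernel_ge0.
rewrite -(ge0_integralZl_EFin mu (mA n) (k0 (t + 1)) (mk _) (ltW c0)).
rewrite -(ge0_integralZl_EFin mu (mA n) (k0 t) (mk _) (ltW t0)).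
have ab : n.+2%:R^-1 < n.+2%:R :> R.
  by rewrite (@lt_trans _ _ 1)// ?ltr1n// invf_lt1// ltr1n.
have dp u s : A n s -> derivable (@powR R ^~ u) s 1.
  by move=> /A_pos s0; apply: derivable_powR; rewrite in_itv/= s0.
have de (s : R) : derivable (fun u => - expR (- (c * u))) s 1.
  by have [] := is_derive_expRM c s.
have cp u s : A n s -> {for s, continuous (@powR R ^~ u)}.
  by move=> As; apply: differentiable_continuous; apply/derivable1_diffP; exact: dp.
have ce (s : R) : {for s, continuous (fun u => - expR (- (c * u)))}.
  by apply: differentiable_continuous; apply/derivable1_diffP; exact: de.
have := @integration_by_parts R (@powR R ^~ t) (fun u => - expR (- (c * u)))
  (fun s => t * s `^ (t - 1)) (fun s => c * expR (- (c * s))) _ _ ab.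
rewrite -/(A n) => ibp.
transitivity (\int[mu]_(x in A n) (x `^ t * (c * expR (- (c * x))))%:E)%E.
  by apply: eq_integral => s _; rewrite /gamma_kernel addrK -EFinM mulrCA.
rewrite ibp.
- congr (_%:E + _)%E.
    rewrite /gamma_kernel !addrK mulrN mulrN opprK addrC//.
  apply/esym; rewrite -[LHS]oppeK -integral_ge0N; last first.
    by move=> s _; rewrite -EFinM lee_fin mulr_ge0 ?gamma_kernel_ge0// ltW.
  congr (- _)%E; apply: eq_integral => s _; rewrite /gamma_kernel -EFinM -EFinN.
  by congr EFin; rewrite mulrN mulrA.
- apply: derivable_within_continuous => s As; apply: derivableM => //.
  exact: dp.
- split.
  + by move=> s /subset_itv_oo_cc As; apply: dp.
  + apply/cvg_at_right_filter; apply: cp; rewrite /A/= in_itv/= lexx ltW//.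
  + apply/cvg_at_left_filter; apply: cp; rewrite /A/= in_itv/= lexx ltW//.
- move=> s /subset_itv_oo_cc As; rewrite powR_derive1// in_itv/= andbT.
  exact: (@A_pos n).
- apply: derivable_within_continuous => s As; apply: derivableM => //.
- split.
  + by move=> s _; exact: de.
  + by apply/cvg_at_right_filter; exact: ce.
  + by apply/cvg_at_left_filter; exact: ce.
- by move=> s _; rewrite derive1E; have [_ ->] := is_derive_expRM c s.
Qed.

(** Integration by parts on compact intervals exhausting ]0, +oo[; the integrands
    being nonnegative, the integrals converge monotonically. *)
Lemma gamma_integralS c t : 0 < c -> 0 < t ->
  (c%:E * gamma_integral c (t + 1) = t%:E * gamma_integral c t)%E.
Proof.
move=> c0 t0.
apply: (@cvg_unique _ _ (c%:E * \int[mu]_(s in A n) (gamma_kernel c (t + 1) s)%:E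
  @[n --> \oo])%E) => //.
  by apply: cvgeZl => //; exact: gamma_integral_cvg.
rewrite (_ : (fun n => _) = (fun n => (gamma_kernel c (t + 1) n.+2%:R^-1 - gamma_kernel c (t + 1) n.+2%:R)%:E +
   t%:E * \int[mu]_(s in A n) (gamma_kernel c t s)%:E)%E); last first.
  by apply/funext => n; exact: by_parts.
rewrite -[(t%:E * gamma_integral c t)%E]add0e; apply: cvgeD => //.
- by apply/fine_cvgP; split; [exact: nearW|exact: boundary_cvg].
- by apply: cvgeZl => //; exact: gamma_integral_cvg.
Qed.

Lemma gamma_integral_ge0 c t : (0 <= gamma_integral c t)%E.
Proof. by apply: integral_ge0 => s _; rewrite lee_fin gamma_kernel_ge0. Qed.

Lemma gamma_integral1 c : 0 < c -> gamma_integral c 1 = (c^-1)%:E.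
Proof.
move=> c0; rewrite /gamma_integral.
under eq_integral do rewrite /gamma_kernel subrr powRr0 mul1r.
have ce : continuous (fun s : R => expR (- (c * s))).
  by move=> s; apply: differentiable_continuous; apply/derivable1_diffP.
rewrite integral_itv_obnd_cbnd; last first.
  by apply/measurable_EFinP; apply: measurable_funTS; exact: continuous_measurable_fun.
rewrite (@ge0_continuous_FTC2y R (fun s => expR (- (c * s)))
  (fun s => - expR (- (c * s)) / c) 0 0).
- by rewrite mulr0 oppr0 expR0 mulNr mul1r EFinN oppeK add0e.
- by move=> x _; exact: expR_ge0.
- by apply: continuous_subspaceT.
- rewrite -[X in _ --> X](mul0r c^-1); apply: cvgM; last exact: cvg_cst.
  rewrite -oppr0; apply: cvgN.
  apply: (@cvg_comp _ _ _ (fun x => c * x) (fun z => expR (- z)) _ (pinfty_nbhs R));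
    last exact: cvgr_expR.
  exact: gt0_cvgMry.
- move=> x _; apply: derivableM => //.
- apply: cvgM; last exact: cvg_cst.
  by apply: cvgN; apply/cvg_at_right_filter; exact: ce.
- move=> x _; rewrite derive1E deriveM//; have [_ ->] := is_derive_expRM c x.
  rewrite derive_cst scaler0 add0r /GRing.scale/= mulrA mulVf ?mul1r//.
  by rewrite gt_eqF.
Qed.

Lemma gamma_integral_nat c n : 0 < c ->
  gamma_integral c n.+1%:R = (n`!%:R / c ^+ n.+1)%:E.
Proof.
move=> c0; elim: n => [|n IHn].
  by rewrite gamma_integral1// fact0 expr1 mul1r.
have := @gamma_integralS c n.+1%:R c0 (ltr0Sn _ _).
rewrite IHn natr1 => /(congr1 (mule (c^-1)%:E)).
rewrite muleA -EFinM mulVf ?gt_eqF// mul1e => ->.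
rewrite -!EFinM; congr EFin; rewrite factS natrM (exprS c n.+1).
by rewrite invfM; ring.
Qed.

(** By the recursion the exponent of [s] may be raised to [t >= 0], and then
    [s `^ t <= 1 + s ^ m] for any integer [m >= t]. *)
Lemma gamma_integral_lty c t : 0 < c -> 0 < t -> (gamma_integral c t < +oo)%E.
Proof.
move=> c0 t0.
suff h : (gamma_integral c (t + 1) < +oo)%E.
  have : (t%:E * gamma_integral c t < +oo)%E.
    by rewrite -gamma_integralS//; apply: lte_mul_pinfty => //; rewrite lee_fin ltW.
  have := gamma_integral_ge0 c t; case: (gamma_integral c t) => [r _ _|_|//]; first exact: ltry.
  by rewrite gt0_muley ?lte_fin// ltxx.
pose m := (Num.truncn t).+1.
have tm : t <= m%:R by exact/ltW/truncnS_gt.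
apply: (@le_lt_trans _ _ (gamma_integral c 1 + gamma_integral c m.+1%:R)%E); last first.
  by rewrite gamma_integral1// gamma_integral_nat// -EFinD ltry.
have k0 u s : (`]0%R, +oo[%classic : set R) s -> (0 <= (gamma_kernel c u s)%:E)%E.
  by move=> _; rewrite lee_fin gamma_kernel_ge0.
have mk u : measurable_fun (`]0%R, +oo[ : set R) (fun s => (gamma_kernel c u s)%:E).
  by apply/measurable_EFinP; exact: measurable_gamma_kernel.
rewrite /gamma_integral.
rewrite -(ge0_integralD mu (measurable_itv _) (k0 _) (mk _) (k0 _) (mk _)).
apply: ge0_le_integral => //.
- by move=> s; exact: k0.
- exact: mk.
- by apply: emeasurable_funD; exact: mk.
move=> s; rewrite /= in_itv/= andbT => s0; rewrite -EFinD lee_fin.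
rewrite /gamma_kernel -mulrDl ler_wpM2r ?expR_ge0// subrr powRr0 addrK.
rewrite -natr1 addrK; have [s1|/ltW s1] := lerP s 1.
  rewrite (@le_trans _ _ 1) ?lerDl ?powR_ge0//.
  have := @ge0_ler_powR R t (ltW t0) s 1; rewrite powR1 !nnegrE; apply => //.
  exact: ltW.
by rewrite (@le_trans _ _ (s `^ m%:R)) ?ler_powR// lerDr.
Qed.

(** Again after raising the exponent, the integrand is bounded below on [[1, 2]]. *)
Lemma gamma_integral_gt0 c t : 0 < c -> 0 < t -> (0 < gamma_integral c t)%E.
Proof.
move=> c0 t0.
suff h : (0 < gamma_integral c (t + 1))%E.
  have : (0 < t%:E * gamma_integral c t)%E by rewrite -gamma_integralS// mule_gt0.
  by rewrite pmule_rgt0.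
apply: (@lt_le_trans _ _ (\int[mu]_(s in `[1%R, 2%R]) (expR (- (c * 2)))%:E)%E).
  rewrite integral_cst//= lebesgue_measure_itv/= lte_fin ltr1n/= -EFinB -EFinM.
  by rewrite lte_fin mulr_gt0 ?expR_gt0// subr_gt0 ltr1n.
have sub : `[1, 2] `<=` (`]0, +oo[ : set R).
  by move=> s; rewrite /= !in_itv/= andbT => /andP[+ _]; exact: lt_le_trans.
apply: (@le_trans _ _ (\int[mu]_(s in `[1%R, 2%R]) (gamma_kernel c (t + 1) s)%:E)%E).
  apply: ge0_le_integral; first exact: measurable_itv.
  - by move=> s _; rewrite lee_fin expR_ge0.
  - exact: measurable_cst.
  - by apply/measurable_EFinP; apply: measurable_funS (measurable_gamma_kernel _ _).
  move=> s; rewrite /= in_itv/= => /andP[s1 s2].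
  rewrite lee_fin /gamma_kernel addrK -[leLHS]mul1r ler_pM ?expR_ge0//.
    by rewrite -(powRr0 s) ler_powR// ltW.
  by rewrite ler_expR lerN2 ler_wpM2l// ltW.
apply: ge0_subset_integral => //.
- by apply/measurable_EFinP; exact: measurable_gamma_kernel.
- by move=> s _; rewrite lee_fin gamma_kernel_ge0.
Qed.

Lemma GammaE t : Gamma t = fine (gamma_integral 1 t).
Proof.
rewrite /Gamma /gamma_integral /Rintegral; congr fine.
by apply: eq_integral => s _; rewrite /gamma_kernel mul1r.
Qed.

Lemma Gamma_gt0 t : 0 < t -> 0 < Gamma t.
Proof.
move=> t0; rewrite GammaE fine_gt0// gamma_integral_gt0//=.
by rewrite gamma_integral_lty.
Qed.

Lemma GammaS t : 0 < t -> Gamma (t + 1) = t * Gamma t.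
Proof.
move=> t0; rewrite !GammaE -[LHS]mul1r.
have fg u : 0 < u -> gamma_integral 1 u \is a fin_num.
  by move=> u0; rewrite ge0_fin_numE ?gamma_integral_ge0// gamma_integral_lty.
have := gamma_integralS ltr01 t0 => /(congr1 fine).
by rewrite !fineM ?fg// addr_gt0.
Qed.

Lemma Gamma_rising t k : 0 < t ->
  Gamma (t + k%:R) = (\prod_(i < k) (t + i%:R)) * Gamma t.
Proof.
move=> t0; elim: k => [|k IHk]; first by rewrite big_ord0 addr0 mul1r.
rewrite -natr1 addrA GammaS ?IHk; last by rewrite ltr_wpDr.
by rewrite big_ord_recr/= mulrCA mulrA.
Qed.

End gamma_integral.

(** * Jump intensities and rising factorials *)

Lemma jump_intensityE (R : realType) (lambda : R) (l : nat) : 0 < lambda ->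
  (0 < l)%N ->
  jump_intensity lambda l = (lambda / (1 + lambda)) ^+ l / l%:R.
Proof.
move=> l0; case: l => // l _; rewrite /jump_intensity.
have c0 : 0 < 1 + lambda by rewrite addr_gt0.
rewrite (_ : Rintegral _ _ _ = fine (gamma_integral (1 + lambda) l.+1%:R)).
  rewrite gamma_integral_nat//= factS natrM exprMn exprVn.
  have f0 : l`!%:R != 0 :> R by rewrite pnatr_eq0 -lt0n fact_gt0.
  have cl0 : (1 + lambda) ^+ l.+1 != 0 by rewrite expf_neq0// gt_eqF.
  move: f0 cl0; move: (l`!%:R) (_ ^+ _) => x y z0 y0.
  by field; rewrite y0 z0 nat1r pnatr_eq0.
rewrite /Rintegral; congr fine; apply: eq_integral => s.
rewrite inE/= in_itv/= andbT => s0; congr EFin.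
rewrite /gamma_kernel /levy_density -natr1 addrK powR_mulrn ?ltW//.
rewrite mulrDl mul1r opprD expRD exprS.
by field; rewrite gt_eqF.
Qed.

Section rising_factorial.
Context {R : realType}.
Implicit Types s h : R.

(** The coefficient of z^k in (1 - z)^(-s). *)
Definition rising_coef (k : nat) s : R := (\prod_(i < k) (s + i%:R)) / k`!%:R.

Lemma rising_coef0 s : rising_coef 0 s = 1.
Proof. by rewrite /rising_coef big_ord0 fact0 divr1. Qed.

Lemma rising_coefS k s :
  k.+1%:R * rising_coef k.+1 s = (s + k%:R) * rising_coef k s.
Proof.
have f0 : k`!%:R != 0 :> R by rewrite pnatr_eq0 -lt0n fact_gt0.
rewrite /rising_coef big_ord_recr/= factS natrM.
move: f0; move: (k`!%:R) (\prod_(_ < _) _) => x y x0.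
by field; rewrite x0 nat1r pnatr_eq0.
Qed.

(** Vandermonde's identity, by induction on [k]: multiply by [k + 1], split this
    factor into [j + (k + 1 - j)] in the [j]-th term, and apply the recursion to
    one of the two coefficients. *)
Lemma rising_coefD k s h : rising_coef k (s + h) =
  \sum_(j < k.+1) rising_coef j s * rising_coef (k - j) h.
Proof.
elim: k => [|k IHk].
  by rewrite big_ord_recl big_ord0 addr0 !rising_coef0 mulr1.
have k0 : k.+1%:R != 0 :> R by rewrite pnatr_eq0.
apply: (mulfI k0); rewrite rising_coefS IHk.
have -> : k.+1%:R * (\sum_(j < k.+2) rising_coef j s * rising_coef (k.+1 - j) h) =
  \sum_(j < k.+2) j%:R * (rising_coef j s * rising_coef (k.+1 - j) h) +
  \sum_(j < k.+2) (k.+1 - j)%:R * (rising_coef j s * rising_coef (k.+1 - j) h).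
  rewrite mulr_sumr -big_split/=; apply: eq_bigr => j _.
  by rewrite -mulrDl -natrD subnKC// -ltnS.
rewrite [X in _ = X + _]big_ord_recl/= mul0r add0r.
rewrite [X in _ = _ + X]big_ord_recr/= subnn mul0r addr0.
rewrite -big_split mulr_sumr; apply: eq_bigr => j _ /=.
have jk : (j <= k)%N by rewrite -ltnS.
rewrite /bump add1n subSS [in RHS]mulrA rising_coefS subSn//.
rewrite [X in _ = _ + X]mulrCA rising_coefS natrB//.
ring.
Qed.

Lemma rising_coef_gt0 k s : 0 < s -> 0 < rising_coef k s.
Proof.
move=> s0; rewrite divr_gt0// ?ltr0n ?fact_gt0// prodr_gt0// => i _.
by rewrite ltr_wpDr.
Qed.

Lemma rising_coef_at0 k : rising_coef k 0 = (k == 0%N)%:R.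
Proof.
case: k => [|k]; first by rewrite rising_coef0.
by rewrite /rising_coef big_ord_recl/= add0r !mul0r.
Qed.

Lemma rising_coef_cvg k :
  rising_coef k.+1 h / h @[h --> 0^'+] --> (k.+1%:R^-1 : R).
Proof.
apply: (@cvg_trans _ ((\prod_(i < k) (h + i.+1%:R)) / k.+1`!%:R @[h --> 0^'+])).
  apply: near_eq_cvg; near=> h.
  rewrite /rising_coef big_ord_recl/= addr0.
  have h0 : h != 0 by rewrite gt_eqF.
  rewrite mulrAC (mulrC h) mulfK//; congr (_ / _).
rewrite (_ : _^-1 = (\prod_(i < k) (0 + i.+1%:R)) / k.+1`!%:R :> R); last first.
  have -> : \prod_(i < k) (0 + i.+1%:R) = k`!%:R :> R.
    rewrite fact_prod natr_prod big_add1 big_mkord.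
    by apply: eq_bigr => i _; rewrite add0r.
  by rewrite factS natrM invfM mulrCA divff ?mulr1// pnatr_eq0 -lt0n fact_gt0.
apply: cvgM; last exact: cvg_cst.
apply: cvg_at_right_filter.
elim: (k) => [|n IHn].
  rewrite big_ord0; under eq_fun do rewrite big_ord0; exact: cvg_cst.
rewrite big_ord_recr/=; under eq_fun do rewrite big_ord_recr/=.
apply: cvgM; first exact: IHn.
by apply: cvgD; [exact: cvg_id|exact: cvg_cst].
Unshelve. all: by end_near. Qed.

End rising_factorial.

(** Cutting [[0, s]] into [n] pieces bounds [D s] by [n] times [o(s / n)]. *)
Lemma subadditive_littleo_eq0 (R : realType) (D : R -> R) :
  (forall s h, 0 <= s -> 0 <= h -> `|D (s + h)| <= `|D s| + `|D h|) ->
  D 0 = 0 -> D h / h @[h --> 0^'+] --> (0 : R) ->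
  forall s, 0 <= s -> D s = 0.
Proof.
move=> subD D0 oD s; rewrite le_eqVlt => /predU1P[<-//|s0].
have Dn n h : 0 <= h -> `|D (n%:R * h)| <= n%:R * `|D h|.
  move=> h0; elim: n => [|n IHn]; first by rewrite !mul0r D0 normr0.
  rewrite -natr1 !mulrDl !mul1r (le_trans (subD _ _ _ _)) ?mulr_ge0//.
  by rewrite lerD2r.
have hn n : 0 < s / n.+1%:R by rewrite divr_gt0.
have hcvg : s / n.+1%:R @[n --> \oo] --> (0 : R).
  by rewrite -[X in _ --> X](mulr0 s); apply: cvgM; [exact: cvg_cst|exact: cvg_harmonic].
have /cvg_at_rightP oDn := oD.
have {}oDn := oDn (fun n => s / n.+1%:R) (conj hn hcvg).
have Dns n : `|D s| <= s * `|D (s / n.+1%:R) / (s / n.+1%:R)|.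
  have sE : s = n.+1%:R * (s / n.+1%:R) by rewrite mulrC divfK// pnatr_eq0.
  rewrite normrM normfV (gtr0_norm (hn n)) [in leLHS]sE.
  apply: (le_trans (Dn _ _ (ltW (hn n)))).
  move: `|D _| => x; rewrite le_eqVlt; apply/orP; left; apply/eqP.
  by field; rewrite nat1r pnatr_eq0/= gt_eqF.
have cvg0 : s * `|D (s / n.+1%:R) / (s / n.+1%:R)| @[n --> \oo] --> s * `|0 : R|.
  by apply: cvgM; [exact: cvg_cst|exact: cvg_norm].
rewrite normr0 mulr0 in cvg0.
apply/eqP; rewrite -normr_le0; apply: (cvgr_to_ge cvg0); exact: nearW.
Qed.

(** * The law of the process at a fixed time *)

Lemma measure_bigcup_fintype d (T : measurableType d) (R : realType)
    (mu : {measure set T -> \bar R}) (I : finType) (F : I -> set T) :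
  (forall i, measurable (F i)) -> trivIset setT F ->
  mu (\bigcup_i F i) = (\sum_(i : I) mu (F i))%E.
Proof.
move=> mF tF; rewrite measure_fin_bigcup//; last exact: finite_finset.
rewrite [RHS](fsbig_seq _ _ (index_enum_uniq I)).
suff -> : [set` index_enum I] = setT by [].
by apply/seteqP; split => // i _ /=; rewrite mem_index_enum.
Qed.

Section one_dimensional_law.
Context d (T : measurableType d) (R : realType) (P : probability T R).
Variables (lambda : R) (N : R -> {RV P >-> nat}).
Hypothesis lambda_gt0 : 0 < lambda.
Hypothesis HN : gamma_poisson_process lambda N.
Implicit Types s t h : R.

Definition marginal (k : nat) h : R := fine (P (N h @^-1` [set k])).

Lemma measurable_level t (B : set nat) : measurable (N t @^-1` B).
Proof. by rewrite -[X in measurable X]setTI; exact: measurable_funP. Qed.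

Lemma measurable_increment s t (B : set nat) :
  measurable (increment N s t @^-1` B).
Proof.
rewrite -[X in measurable X]setTI.
by apply: measurable_fun_subn => //; exact: measurable_funP.
Qed.

Lemma marginal_ge0 k h : 0 <= marginal k h.
Proof. exact: fine_ge0. Qed.

Lemma marginal_le1 k h : marginal k h <= 1.
Proof.
rewrite -lee_fin fineK ?probability_le1 ?fin_num_measure//;
  exact: measurable_level.
Qed.

Lemma increment0 t : increment N 0 t = N t.
Proof. by apply/funext => w; rewrite /increment (gp_start HN) subn0. Qed.

Lemma probability_increment k s t : 0 <= s -> s <= t ->
  P (increment N s t @^-1` [set k]) = (marginal k (t - s))%:E.
Proof.
move=> s0 st; have := gp_stationary_increments HN [set k] s0 (lexx 0).
move=> /(_ (t - s)); rewrite subrKC add0r increment0 subr_ge0 => ->//.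
by rewrite fineK// fin_num_measure//; exact: measurable_level.
Qed.

Lemma probability_increments n (u : nat -> R) (v : nat -> nat) :
  0 <= u 0%N -> (forall i, u i <= u i.+1) ->
  P [set w | forall i, (i < n)%N -> increment N (u i) (u i.+1) w = v i] =
  (\prod_(i < n) marginal (v i) (u i.+1 - u i))%:E.
Proof.
move=> u0 ndu.
have u_ge0 i : 0 <= u i by elim: i => // i IHi; exact: le_trans (ndu i).
have := @gp_independent_increments _ _ _ _ _ _ HN n u u0 ndu [set: 'I_n]%SET
  (fun i => [set v i]) (fun=> I).
rewrite (_ : \bigcap_(i in _) _ =
  [set w | forall i, (i < n)%N -> increment N (u i) (u i.+1) w = v i]).
  move=> ->; rewrite -prodEFin.
  apply: eq_big => [i|i _]; first by rewrite inE.
  exact: probability_increment.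
apply/seteqP; split => w /= Hw i.
  by move=> ni; have := Hw (Ordinal ni); apply; rewrite /= inE.
by move=> _; exact: Hw.
Qed.

Lemma marginal_semigroup k s h : 0 <= s -> 0 <= h ->
  marginal k (s + h) = \sum_(j < k.+1) marginal j s * marginal (k - j) h.
Proof.
move=> s0 h0.
pose A (j : nat) : set T := N s @^-1` [set j] `&`
  increment N s (s + h) @^-1` [set (k - j)%N].
have mA j : measurable (A j).
  by apply: measurableI; [exact: measurable_level|exact: measurable_increment].
have PA j : P (A j) = (marginal j s * marginal (k - j) h)%:E.
  pose u i := if i is i'.+1 then (if i' is _.+1 then s + h else s) else 0.
  pose v i := if i is 0%N then j else (k - j)%N.
  have := @probability_increments 2 u v (lexx _).
  rewrite !big_ord_recl big_ord0 /= subr0 mulr1 addrAC subrr add0r => <-.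
    congr (P _); apply/seteqP; split => w /=.
      by move=> [H1 H2] [|[|//]] _ //=; rewrite increment0.
    move=> H; split; first by have := H 0%N erefl; rewrite /= increment0.
    exact: (H 1%N erefl).
  by move=> [|[|i]] //=; rewrite lerDl.
have -> : \sum_(j < k.+1) marginal j s * marginal (k - j) h =
    fine (\sum_(j < k.+1) P (A j))%E.
  by under [in RHS]eq_bigr do rewrite PA; rewrite sumEFin.
rewrite -(measure_bigcup_fintype P (fun j : 'I_k.+1 => mA j)); last first.
  apply/trivIsetP => i j _ _ ij; rewrite -subset0 => w [[/= Ni _] [/= Nj _]].
  by rewrite -val_eqE/= -Ni -Nj eqxx in ij.
congr (fine (P _)); apply/seteqP; split => w /=.
  have := gp_nondecreasing HN w s0 (ler_wpDr h0 (lexx s)).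
  rewrite /A/= => Nle Nk; rewrite Nk in Nle.
  by exists (Ordinal (Nle : N s w < k.+1)%N) => //=; rewrite /increment Nk.
move=> [j _ []]/= Nj; rewrite /increment Nj => Nkj.
have := gp_nondecreasing HN w s0 (ler_wpDr h0 (lexx s)); rewrite Nj => Nle.
by rewrite -(subnK Nle) Nkj subnK// -ltnS.
Qed.

Lemma marginal0 k : marginal k 0 = (k == 0%N)%:R.
Proof.
rewrite /marginal; case: k => [|k] /=.
  rewrite (_ : N 0 @^-1` _ = setT) ?probability_setT//.
  by apply/seteqP; split => // w _ /=; rewrite (gp_start HN).
rewrite (_ : N 0 @^-1` _ = set0) ?measure0//.
by apply/seteqP; split => // w /=; rewrite (gp_start HN).
Qed.

Let littleo_cvg (f g : R -> R) :
  (forall e, 0 < e -> \forall h \near 0^'+, `|(f - g) h| <= e * `|h|) ->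
  (f h - g h) / h @[h --> 0^'+] --> (0 : R).
Proof.
move=> o; apply/cvgr0Pnorm_le => e e0.
near=> h; have h0 : 0 < h by [].
rewrite normrM normfV (gtr0_norm h0) ler_pdivrMr//.
have : `|(f - g) h| <= e * `|h| by near: h; exact: (o e e0).
by rewrite (gtr0_norm h0).
Unshelve. all: by end_near. Qed.

Lemma marginal_cvg k : (0 < k)%N ->
  marginal k h / h @[h --> 0^'+] --> jump_intensity lambda k.
Proof.
move=> k0; have := gp_jump HN (lexx 0) k0.
move=> /funext/eqadd_some_oP/littleo_cvg o.
have : marginal k h / h - jump_intensity lambda k @[h --> 0^'+] --> (0 : R).
  apply: cvg_trans o; apply: near_eq_cvg; near=> h.
  have h0 : h != 0 by rewrite gt_eqF.
  by rewrite add0r increment0 mulrBl mulrAC mulfV// mul1r.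
by move/subr_cvg0.
Unshelve. all: by end_near. Qed.

Lemma marginal0_cvg :
  (marginal 0 h - 1) / h @[h --> 0^'+] --> - total_intensity lambda.
Proof.
have := gp_no_jump HN (lexx 0).
move=> /funext/eqadd_some_oP/littleo_cvg o.
have : (marginal 0 h - 1) / h - - total_intensity lambda @[h --> 0^'+] --> (0 : R).
  apply: cvg_trans o; apply: near_eq_cvg; near=> h.
  have h0 : h != 0 by rewrite gt_eqF.
  by rewrite add0r increment0 opprB opprK addrCA !mulrDl mulrAC mulfV// mul1r; ring.
by move/subr_cvg0.
Unshelve. all: by end_near. Qed.

Lemma total_intensity_ge0 : 0 <= total_intensity lambda.
Proof.
apply: Rintegral_ge0 => s; rewrite /= in_itv/= andbT => s0.
apply: mulr_ge0; last by rewrite divr_ge0 ?expR_ge0 ?ltW.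
by rewrite subr_ge0 -expR0 ler_expR oppr_le0 mulr_ge0// ltW.
Qed.

(* The claimed law is negative binomial, up to the value of theta. *)
Let theta := total_intensity lambda.
Let x := lambda / (1 + lambda).
Let nbinom k s : R := expR (- (theta * s)) * x ^+ k * rising_coef k s.

Let nbinom0 s : nbinom 0 s = expR (- (theta * s)).
Proof. by rewrite /nbinom rising_coef0 !mulr1. Qed.

Let nbinom0_cvg : (nbinom 0 h - 1) / h @[h --> 0^'+] --> - theta.
Proof.
have dE : is_derive (0 : R) 1 (fun s => expR (- (theta * s))) (- theta).
  by apply: is_derive_eq; rewrite mulr0 oppr0 expR0 mul1r /GRing.scale/= mulr1.
have [dv dval] := dE; rewrite -dval.
apply: cvg_dnbhs_at_right; apply: cvg_trans dv; apply: near_eq_cvg; near=> h.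
by rewrite nbinom0 /= addr0 mulr0 oppr0 expR0 /GRing.scale/= mulr1 mulrC.
Unshelve. all: by end_near. Qed.

Let nbinomD k s h : nbinom k (s + h) =
  \sum_(j < k.+1) nbinom j s * nbinom (k - j) h.
Proof.
rewrite {1}/nbinom rising_coefD mulr_sumr; apply: eq_bigr => j _.
have jk : (j <= k)%N by rewrite -ltnS.
rewrite /nbinom mulrDr opprD expRD -{1}(subnKC jk) exprD; ring.
Qed.

(** Both sides are convolution semigroups in [s]. If they agree for all smaller
    values of [k], only the two extreme terms of the convolution sums differ; as
    the factors involved lie in [[0, 1]], the difference is subadditive. The jump
    axioms make it [o(h)] at [0]. *)
Lemma marginalE k s : 0 <= s -> marginal k s =
  expR (- (total_intensity lambda * s)) * (lambda / (1 + lambda)) ^+ k *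
    rising_coef k s.
Proof.
rewrite -/theta -/x -/(nbinom k s).
have b_ge0 h : 0 <= nbinom 0 h by rewrite nbinom0 expR_ge0.
have b_le1 h : 0 <= h -> nbinom 0 h <= 1.
  by move=> h0; rewrite nbinom0 -expR0 ler_expR oppr_le0 mulr_ge0// total_intensity_ge0.
have subD k' : (forall j, (j < k')%N -> forall s, 0 <= s -> marginal j s = nbinom j s) ->
    forall s h, 0 <= s -> 0 <= h ->
    `|marginal k' (s + h) - nbinom k' (s + h)| <=
    `|marginal k' s - nbinom k' s| + `|marginal k' h - nbinom k' h|.
  (* only the terms j = 0 and j = k' survive in the difference of the sums *)
  move=> IH s' h s0 h0; rewrite marginal_semigroup// nbinomD -sumrB.
  have le1 (u a : R) : 0 <= a <= 1 -> `|u * a| <= `|u|.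
    by move=> /andP[a0 a1]; rewrite normrM (ger0_norm a0) ler_piMr.
  case: k' IH => [|k'] IH.
    rewrite !big_ord_recl !big_ord0 !addr0/=.
    rewrite (_ : _ - _ = (marginal 0 s' - nbinom 0 s') * marginal 0 h +
      (marginal 0 h - nbinom 0 h) * nbinom 0 s'); last by ring.
    apply: (le_trans (ler_normD _ _)); apply: lerD.
      by rewrite le1// marginal_ge0 marginal_le1.
    by rewrite le1// b_ge0 b_le1.
  rewrite big_ord_recl big_ord_recr/= big1 ?add0r => [|j _]; last first.
    by rewrite /bump/= add1n subSS !IH ?subrr//  ltnS// leq_subr.
  rewrite subn0 /bump/= add1n subnn !(IH 0%N)//.
  rewrite -mulrBr -mulrBl addrC [X in _ + X]mulrC.
  apply: (le_trans (ler_normD _ _)); apply: lerD.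
    by rewrite le1// b_ge0 b_le1.
  by rewrite le1// b_ge0 b_le1.
elim/ltn_ind: k s => k IH s s0.
apply/eqP; rewrite -subr_eq0; apply/eqP; move: s s0.
apply: (@subadditive_littleo_eq0 _ (fun s => marginal k s - nbinom k s)).
- exact: subD.
- rewrite marginal0 /nbinom rising_coef_at0 mulr0 oppr0 expR0 mul1r.
  by case: (k) => [|?]; rewrite ?expr0 ?mul1r ?mulr0 subrr.
case: k {IH} => [|k].
  have c0 : (marginal 0 h - 1) / h - (nbinom 0 h - 1) / h @[h --> 0^'+] --> (0 : R).
    rewrite -[X in _ --> X](subrr (- theta)); apply: cvgB; last exact: nbinom0_cvg.
    exact: marginal0_cvg.
  apply: cvg_trans c0; apply: near_eq_cvg; near=> h.
  by rewrite /= -mulrBl; congr (_ / _); ring.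
suff c : expR (- (theta * h)) * x ^+ k.+1 * (rising_coef k.+1 h / h) @[h --> 0^'+]
    --> x ^+ k.+1 / k.+1%:R.
  have c0 : marginal k.+1 h / h - expR (- (theta * h)) * x ^+ k.+1 *
      (rising_coef k.+1 h / h) @[h --> 0^'+] --> (0 : R).
    rewrite -[X in _ --> X](subrr (x ^+ k.+1 / k.+1%:R)); apply: cvgB => //.
    by rewrite -jump_intensityE//; exact: marginal_cvg.
  apply: cvg_trans c0; apply: near_eq_cvg; near=> h.
  by rewrite /= mulrBl /nbinom; ring.
apply: cvgM; last exact: rising_coef_cvg.
rewrite -[X in _ --> X]mul1r; apply: cvgM; last exact: cvg_cst.
have c0 : is_derive (0 : R) 1 (fun s => expR (- (theta * s)))
    (expR (- (theta * 0)) * - theta).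
  by apply: is_derive_eq; rewrite /GRing.scale/= mulr1.
have [/derivable1_diffP/differentiable_continuous c1 _] := c0.
have : expR (- (theta * h)) @[h --> (0 : R)] --> expR (- (theta * 0)) by exact: c1.
by rewrite mulr0 oppr0 expR0; exact: cvg_at_right_filter.
Unshelve. all: by end_near. Qed.

End one_dimensional_law.

(** * Pure-jump paths *)

Section counting_path.
Context {R : realType}.
Implicit Types (f g : R -> nat) (s t u : R).

(** The paths of the process, restricted to nonnegative times. *)
Definition counting_path f : Prop :=
  [/\ f 0 = 0%N,
      forall s t, 0 <= s -> s <= t -> (f s <= f t)%N &
      forall t, 0 <= t -> \forall u \near t^'+, f u = f t].

Lemma at_right_itv s (A : set R) : (\forall u \near s^'+, A u) ->
  exists2 e, 0 < e & forall u, s < u -> u < s + e -> A u.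
Proof.
move=> /nbhs_ballP[e /= e0 sA]; exists e => // u su use; apply: sA => //.
by rewrite /ball/= distrC ger0_norm ?subr_ge0 ?ltW// ltrBlDl.
Qed.

(** The passage time is an infimum, which right continuity attains. *)
Lemma first_passage f m b : counting_path f -> (0 < m)%N -> 0 <= b -> (m <= f b)%N ->
  exists2 s, 0 < s <= b &
    forall u, 0 <= u -> ((u < s) -> (f u < m)%N) /\ ((s <= u) -> (m <= f u)%N).
Proof.
move=> [f0 fnd frc] m0 b0 mfb.
pose S := [set u | 0 <= u /\ (m <= f u)%N].
have Sb : S b by [].
have infS : has_inf S by split; [exists b|exists 0 => u []].
have s0 : 0 <= inf S by apply: lb_le_inf; [exists b|move=> u []].
have fs : (m <= f (inf S))%N.
  have [e e0 He] := at_right_itv (frc _ s0).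
  have [u Su ulte] := inf_adherent e0 infS.
  have := inf_lbound infS.2 Su.
  rewrite le_eqVlt => /predU1P[->|su]; first by case: Su.
  by rewrite -(He u)//; case: Su.
exists (inf S).
  rewrite (inf_lbound infS.2 Sb) andbT lt_neqAle s0 andbT.
  by apply/negP => /eqP E; move: fs; rewrite -E f0 leqNgt m0.
move=> u u0; split => [us|su].
  rewrite ltnNge; apply/negP => mfu.
  by have := inf_lbound infS.2 (conj u0 mfu : S u); rewrite leNgt us.
exact: leq_trans (fnd _ _ s0 su).
Qed.

(** The value of [f] just before [s] is its maximum on [[0, s[]: a nondecreasing
    integer-valued function is constant from the point where it reaches it. *)
Lemma counting_path_left f s : counting_path f -> 0 < s ->
  exists2 c, (c <= f s)%N & \forall u \near s^'-, f u = c.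
Proof.
move=> [f0 fnd _] s0.
pose p n := `[< exists2 u, 0 <= u < s & f u = n >].
have exp : exists n, p n by exists 0%N; apply/asboolP; exists 0; rewrite ?lexx.
have bp n : p n -> (n <= f s)%N.
  by move=> /asboolP[u /andP[u0 us] <-]; exact: fnd (ltW us).
case: (ex_maxnP exp bp) => c pc cmax; exists c; first exact: bp.
have /asboolP[v /andP[v0 vs] fv] := pc.
near=> u.
have vu : v <= u by apply: ltW; near: u; exact: nbhs_left_gt.
have us : u < s by [].
apply/eqP; rewrite eqn_leq -{2}fv fnd// andbT.
by apply: cmax; apply/asboolP; exists u => //; rewrite us (le_trans v0).
Unshelve. all: by end_near. Qed.

Lemma jump_heightE f s c : (\forall u \near s^'-, f u = c) ->
  jump_height f s = (f s - c)%N.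
Proof.
move=> fc; rewrite /jump_height; congr subn; apply: cvg_lim.
  exact: discrete_hausdorff.
by apply/discrete_cvg; exact: fc.
Qed.

(** At the infimum of the times where the paths differ, they have equal left
    limits and equal jumps, hence equal values; by right continuity they then agree
    a little further, a contradiction. *)
Lemma eq_jump_height f g t : counting_path f -> counting_path g ->
  (forall s, 0 < s <= t -> jump_height f s = jump_height g s) ->
  forall s, 0 <= s <= t -> f s = g s.
Proof.
move=> pf pg fg v v0t; apply/eqP/negPn/negP => /eqP fgv.
pose S := [set u | 0 <= u <= t /\ f u <> g u].
have Sv : S v by [].
have infS : has_inf S by split; [exists v|exists 0 => u [/andP[]]].
set s := inf S.
have s0 : 0 <= s by apply: lb_le_inf; [exists v|move=> u [/andP[]]].
have st : s <= t by apply: (le_trans (inf_lbound infS.2 Sv)); case/andP: v0t.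
have eqlt u : 0 <= u -> u < s -> f u = g u.
  move=> u0 us; apply: contrapT => fgu.
  have Su : S u by split=> //; rewrite u0 (le_trans (ltW us)).
  by have := inf_lbound infS.2 Su; rewrite leNgt us.
have fgs : f s = g s.
  have [[f0 _ _] [g0 _ _]] := (pf, pg).
  move: s0; rewrite le_eqVlt => /predU1P[<-|s0]; first by rewrite f0 g0.
  have [c cf fc] := counting_path_left pf s0.
  have [c' cg gc] := counting_path_left pg s0.
  have cc' : c = c'.
    near (s^'-)%R => u.
    have <- : f u = c by near: u.
    have <- : g u = c' by near: u.
    by apply: eqlt => //; apply: ltW; near: u; exact: nbhs_left_gt.
  have := fg s; rewrite s0 st => /(_ erefl).
  rewrite (jump_heightE fc) (jump_heightE gc) -cc' => /(congr1 (addn^~ c)).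
  by rewrite !subnK// cc'.
have [_ _ /(_ _ s0) rf] := pf; have [_ _ /(_ _ s0) rg] := pg.
have [e e0 He] := at_right_itv (filterI rf rg).
have [u Su ue] := inf_adherent e0 infS.
have := inf_lbound infS.2 Su; rewrite -/s le_eqVlt => /predU1P[su|su].
  by case: Su; rewrite -su fgs.
by case: Su => _; apply; have [-> ->] := He u su ue.
Unshelve. all: by end_near. Qed.

End counting_path.

Section step_path.
Context {R : realType} (r : nat) (l : 'I_r -> nat) (x : r.-tuple R).
Hypothesis x_gt0 : forall j, 0 < tnth x j.
Implicit Types s t u : R.

(** The path which jumps by [l j] at time [tnth x j]. *)
Definition step_path s : nat := (\sum_(j < r | (tnth x j <= s)%R) l j)%N.

Lemma counting_step_path : counting_path step_path.
Proof.
split=> [|s t _ st|t t0].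
- by rewrite /step_path big1// => j; rewrite leNgt x_gt0.
- rewrite /step_path [leqRHS](bigID (fun j => tnth x j <= s))/=.
  rewrite [X in (_ <= X + _)%N](eq_bigl (fun j => tnth x j <= s)) ?leq_addr// => j.
  by case: (lerP _ s) => [js|]; rewrite ?andbF// (le_trans js).
- have : \forall u \near t^'+, forall j, (tnth x j <= u) = (tnth x j <= t).
    apply: filter_forall => j; have [jt|tj] := lerP (tnth x j) t.
      by near=> u; apply: (le_trans jt); exact: ltW.
    near=> u; apply/negbTE; rewrite -ltNge; near: u; exact: nbhs_right_lt.
  by apply: filterS => u jE; apply: eq_bigl.
Unshelve. all: by end_near. Qed.

Lemma jump_height_step_path s : jump_height step_path s =
  (\sum_(j < r | tnth x j == s) l j)%N.
Proof.
rewrite (@jump_heightE _ _ _ (\sum_(j < r | (tnth x j < s)%R) l j)%N).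
  rewrite /step_path (bigID (fun j => tnth x j < s))/=.
  rewrite (eq_bigl (fun j => tnth x j < s)); last first.
    by move=> j; rewrite -[RHS]andbT andbC; case: ltP => //= /ltW ->.
  rewrite addKn; apply: eq_bigl => j.
  by rewrite -leNgt eq_le.
have : \forall u \near s^'-, forall j, (tnth x j <= u) = (tnth x j < s).
  apply: filter_forall => j; have [js|sj] := ltrP (tnth x j) s.
    by near=> u; apply: ltW; near: u; exact: nbhs_left_gt.
  near=> u; apply/negbTE; rewrite -ltNge; apply: lt_le_trans sj; by [].
by apply: filterS => u jE; apply: eq_bigl.
Unshelve. all: by end_near. Qed.

End step_path.

(** * Prescribed jumps as step functions *)

Lemma leq_sum_subpred (I : finType) (p q : pred I) (F : I -> nat) :
  (forall i, p i -> q i) -> (\sum_(i | p i) F i <= \sum_(i | q i) F i)%N.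
Proof.
move=> pq; rewrite big_mkcond [leqRHS]big_mkcond leq_sum// => i _.
by case: ifPn => // /pq ->.
Qed.

Section jumps_and_steps.
Context {R : realType} (r : nat) (l : 'I_r -> nat) (t : R).
Hypothesis l_gt0 : forall j, (1 <= l j)%N.
Hypothesis t_gt0 : 0 < t.
Implicit Types (s u : R) (x : r.-tuple R) (f : R -> nat).

(** The height reached by the path after its first [j] jumps. *)
Definition level (j : nat) : nat := (\sum_(i < r | (i < j)%N) l i)%N.

Lemma levelS (j : 'I_r) : level j.+1 = (level j + l j)%N.
Proof.
rewrite /level (bigD1 j)//= addnC; congr addn; apply: eq_bigl => i.
by rewrite ltnS ltn_neqAle -val_eqE andbC.
Qed.

Lemma level_ltS (j : 'I_r) : (level j < level j.+1)%N.
Proof. by rewrite levelS -addn1 leq_add2l. Qed.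

Lemma level_mono i j : (i <= j)%N -> (level i <= level j)%N.
Proof. by move=> ij; apply: leq_sum_subpred => k /leq_trans; exact. Qed.

Lemma level0 : level 0 = 0%N.
Proof. by rewrite /level big_pred0. Qed.

Lemma level_size : level r = (\sum_(j < r) l j)%N.
Proof. by apply: eq_bigl => j; rewrite ltn_ord. Qed.

Lemma open_simplexP x : open_simplex r t x <->
  (forall j, 0 < tnth x j < t) /\
  (forall i j : 'I_r, (i < j)%N -> tnth x i < tnth x j).
Proof.
rewrite /open_simplex/= path_pairwise; last exact: lt_trans.
rewrite pairwise_cons pairwise_rcons all_rcons t_gt0/=.
split=> [/and3P[/all_tnthP x0 /all_tnthP xt /(pairwiseP 0) xs]|[x0t xs]].
  split=> [j|i j ij]; first by rewrite x0 xt.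
  by rewrite !(tnth_nth 0); apply: xs; rewrite ?inE ?size_tuple.
apply/and3P; split.
- by apply/all_tnthP => j; have /andP[] := x0t j.
- by apply/all_tnthP => j; have /andP[] := x0t j.
apply/(pairwiseP 0) => i j; rewrite !inE !size_tuple => ir jr ij.
by have := xs (Ordinal ir) (Ordinal jr) ij; rewrite !(tnth_nth 0).
Qed.

Lemma open_simplex_sorted x : open_simplex r t x -> sorted <%R x.
Proof. by rewrite /open_simplex/= -cats1 cat_path => /andP[/path_sorted]. Qed.

Section fixed_path.
Variable f : R -> nat.
Hypothesis path_f : counting_path f.

(** Two paths with the same jumps coincide; conversely the jumps at times of
    ]0, t] only depend on the path up to time [t]. *)
Lemma jumps_stepP x : open_simplex r t x ->
  (jump_times f t = [set` x] /\ forall j, jump_height f (tnth x j) = l j) <->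
  (forall s, 0 <= s <= t -> f s = step_path l x s).
Proof.
move=> xD; have [x0t xs] := (open_simplexP x).1 xD.
have x0 j : 0 < tnth x j by have /andP[] := x0t j.
have ux := lt_sorted_uniq (open_simplex_sorted xD).
have stepj j : (\sum_(i < r | tnth x i == tnth x j) l i)%N = l j.
  rewrite (eq_bigl (pred1 j)) ?big_pred1_eq// => i /=.
  by rewrite (inj_eq (tuple_uniqP _ ux)).
have pstep := counting_step_path l x0.
split=> [[fx fl]|fE].
  apply: (eq_jump_height path_f pstep) => s s0t.
  rewrite jump_height_step_path//.
  have [/tnthP[j ->]|sx] := boolP (s \in x); first by rewrite stepj.
  rewrite big1 => [|j /eqP xj]; last by rewrite -xj mem_tnth in sx.
  apply/eqP/negPn; apply: contra sx => fs.
  by have : jump_times f t s by []; rewrite fx.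
have fjump s : 0 < s <= t -> jump_height f s = jump_height (step_path l x) s.
  move=> /andP[s0 st]; have [c _ near_c] := counting_path_left pstep s0.
  rewrite (jump_heightE near_c) (@jump_heightE _ _ _ c) ?fE// ?st ?ltW//.
  near=> u; rewrite fE; first by near: u.
  apply/andP; split; first by apply: ltW; near: u; exact: nbhs_left_gt.
  by rewrite (le_trans _ st)// ltW.
split=> [|j]; last first.
  have /andP[xj0 /ltW xjt] := x0t j.
  by rewrite fjump ?xj0// jump_height_step_path// stepj.
apply/seteqP; split => s /=.
  move=> [s0t]; rewrite fjump// jump_height_step_path//.
  apply: contra_neqT => sx; rewrite big1// => j /eqP xj.
  by rewrite -xj mem_tnth in sx.
move=> /tnthP[j ->]; have /andP[xj0 /ltW xjt] := x0t j; split; first by rewrite xj0.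
rewrite fjump ?xj0// jump_height_step_path stepj -lt0n; exact: l_gt0.
Unshelve. all: by end_near. Qed.

Lemma step_path_level_ge x s j : open_simplex r t x -> tnth x j <= s ->
  (level j.+1 <= step_path l x s)%N.
Proof.
move=> /open_simplexP[_ xs] xjs; apply: leq_sum_subpred => i.
rewrite ltnS leq_eqVlt => /predU1P[/val_inj ->//|ij].
by rewrite (le_trans _ xjs)// ltW// xs.
Qed.

Lemma step_path_level_le x s (j : 'I_r) : open_simplex r t x -> s < tnth x j ->
  (step_path l x s <= level j)%N.
Proof.
move=> /open_simplexP[_ xs] sxj; apply: leq_sum_subpred => i xis.
rewrite ltnNge leq_eqVlt; apply/negP => /predU1P[/val_inj ji|ji].
  by rewrite -ji leNgt sxj in xis.
by have := lt_trans (le_lt_trans xis sxj) (xs _ _ ji); rewrite ltxx.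
Qed.

Lemma step_path_end x : open_simplex r t x -> step_path l x t = level r.
Proof.
move=> /open_simplexP[x0t _]; rewrite level_size; apply: eq_bigl => j.
by have /andP[_ /ltW ->] := x0t j.
Qed.

(** If [m] coordinates of [x] are at most [s], the bounds pin [f s] to [level m]
    from both sides; for [m = r] the upper bound is the final value [f t]. *)
Lemma step_path_unique x : open_simplex r t x -> f t = level r ->
  (forall (j : 'I_r) s, 0 <= s <= t -> s < tnth x j -> (f s <= level j)%N) ->
  (forall (j : 'I_r) s, 0 <= s <= t -> tnth x j <= s -> (level j.+1 <= f s)%N) ->
  forall s, 0 <= s <= t -> f s = step_path l x s.
Proof.
move=> /open_simplexP[x0t xs] ft fle fge s s0t.
(* m is the number of coordinates of x which are at most s *)
pose p m := [forall i : 'I_r, (m <= i)%N ==> (s < tnth x i)].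
have exp : exists m, p m.
  by exists r; apply/forallP => i; rewrite leqNgt ltn_ord.
case: (ex_minnP exp) => m /forallP pm mmin.
have mr : (m <= r)%N.
  by apply: mmin; apply/forallP => i; rewrite leqNgt ltn_ord.
have ltm (i : 'I_r) : (i < m)%N -> tnth x i <= s.
  move=> im; rewrite leNgt; apply/negP => six.
  suff /mmin : p i by rewrite leqNgt im.
  apply/forallP => j; apply/implyP; rewrite leq_eqVlt => /predU1P[/val_inj <-//|].
  by move=> /xs; exact: lt_trans.
have -> : step_path l x s = level m.
  apply: eq_bigl => i; have [im|mi] := ltnP i m; first by rewrite ltm.
  by have := pm i; rewrite mi/= leNgt => ->.
apply/eqP; rewrite eqn_leq; apply/andP; split.
  move: mr; rewrite leq_eqVlt => /predU1P[->|mr].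
    have [_ fnd _] := path_f; rewrite -ft.
    by have /andP[s0 st] := s0t; exact: fnd.
  by apply: (fle (Ordinal mr)) => //; have := pm (Ordinal mr); rewrite leqnn.
case: m {pm mmin} mr ltm => [|m] mr ltm; first by rewrite level0.
by apply: (fge (Ordinal mr)) => //; apply: ltm.
Qed.

End fixed_path.
End jumps_and_steps.

(** * Dyadic approximation of the jump times in a box *)

Section dyadic_grid.
Context {R : realType}.
Implicit Types a b : R.

Definition grid a b (n i : nat) : R := a + (b - a) * (i%:R / (2 ^ n)%:R).

Let pow2_neq0 n : (2 ^ n)%:R != 0 :> R.
Proof. by rewrite pnatr_eq0 expn_eq0. Qed.

Lemma grid0 a b n : grid a b n 0 = a.
Proof. by rewrite /grid mul0r mulr0 addr0. Qed.

Lemma grid_end a b n : grid a b n (2 ^ n) = b.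
Proof. by rewrite /grid divff// mulr1 subrKC. Qed.

Lemma grid_le a b n i j : a <= b -> (i <= j)%N -> grid a b n i <= grid a b n j.
Proof.
by move=> ab ij; rewrite lerD2l ler_wpM2l ?subr_ge0// ler_wpM2r ?invr_ge0// ler_nat.
Qed.

Lemma gridS a b n i : grid a b n i.+1 - grid a b n i = (b - a) / (2 ^ n)%:R.
Proof. by rewrite /grid -natr1; field. Qed.

Lemma grid_double a b n i : grid a b n.+1 i.*2 = grid a b n i.
Proof.
rewrite /grid expnS -mul2n !natrM.
by have := pow2_neq0 n; move: ((2 ^ n)%:R) => x x0; congr (_ + _ * _); field.
Qed.

Lemma grid_itv a b n i : a <= b -> (i < 2 ^ n)%N ->
  a <= grid a b n i /\ grid a b n i.+1 <= b.
Proof.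
move=> ab i2; split; first by rewrite -[leLHS](grid0 a b n) grid_le.
by rewrite -[leRHS](grid_end a b n) grid_le.
Qed.

Lemma grid_cell a b n u : a < u <= b ->
  exists i : 'I_(2 ^ n), grid a b n i < u <= grid a b n i.+1.
Proof.
move=> /andP[au ub].
have exi : exists i, u <= grid a b n i by exists (2 ^ n)%N; rewrite grid_end.
case: (ex_minnP exi) => -[|i] ui imin; first by rewrite grid0 leNgt au in ui.
have i2 : (i < 2 ^ n)%N by apply: imin; rewrite grid_end.
exists (Ordinal i2); rewrite ui andbT ltNge /=.
by apply/negP => /imin; rewrite ltnn.
Qed.

Lemma grid_mesh a b e : 0 < e -> exists n, (b - a) / (2 ^ n)%:R < e.
Proof.
move=> e0; exists (Num.truncn ((b - a) / e)).+1.
rewrite ltr_pdivrMr ?ltr0n ?expn_gt0//.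
rewrite mulrC -ltr_pdivrMr// (lt_le_trans (truncnS_gt _))// ler_nat.
by rewrite ltnW// ltn_expl.
Qed.

End dyadic_grid.

Section boxes.
Context {R : realType} (r : nat) (l : 'I_r -> nat) (t : R).
Hypothesis l_gt0 : forall j, (1 <= l j)%N.
Hypothesis t_gt0 : 0 < t.
Variables (a b : 'I_r -> R).
Implicit Types (s u : R) (x : r.-tuple R) (f : R -> nat).
Notation level := (level l).

Definition box (a b : 'I_r -> R) : set (r.-tuple R) :=
  [set x | forall j, `]a j, b j]%classic (tnth x j)].

(** The sides follow one another in ]0, t[, so that the coordinates of a point
    of the box automatically come in increasing order. *)
Definition ordered_box (a b : 'I_r -> R) : Prop :=
  [/\ forall j, 0 <= a j, forall j, b j < t &
      forall i j : 'I_r, (i < j)%N -> b i <= a j].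

Hypothesis ab_ordered : ordered_box a b.

Lemma box_open_simplex : box a b `<=` open_simplex r t.
Proof.
have [a0 bt ba] := ab_ordered.
move=> x xab; apply/open_simplexP => //; split => [j|i j ij].
  have := xab j; rewrite /= in_itv/= => /andP[ax xb].
  by rewrite (le_lt_trans (a0 j))// (le_lt_trans xb).
have := xab j; have := xab i; rewrite /= !in_itv/= => /andP[_ xb] /andP[ax _].
by rewrite (le_lt_trans xb)// (le_lt_trans (ba _ _ ij)).
Qed.

(** The path climbs from level [j] to level [j + 1] between [lo j] and [hi j]. For
    ordered intervals the inequalities are in fact equalities; stated this way they
    visibly persist when the intervals grow. *)
Definition crosses f (lo hi : 'I_r -> R) : Prop :=
  f t = level r /\
  forall j : 'I_r, (f (lo j) <= level j)%N /\ (level j.+1 <= f (hi j))%N.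

(** Each climb takes place within one cell of the [n]-th dyadic subdivision of the
    corresponding side of the box. *)
Definition grid_crosses f n : Prop := exists I : {ffun 'I_r -> 'I_(2 ^ n)},
  crosses f (fun j => grid (a j) (b j) n (I j))
            (fun j => grid (a j) (b j) n (I j).+1).

Hypothesis ab_le : forall j, a j <= b j.

Let grid_range n j (i : 'I_(2 ^ n)) :
  [/\ 0 <= grid (a j) (b j) n i, grid (a j) (b j) n i <= t,
      0 <= grid (a j) (b j) n i.+1 & grid (a j) (b j) n i.+1 <= t].
Proof.
have [a0 bt _] := ab_ordered.
have [ag gb] := grid_itv (ab_le j) (ltn_ord i).
have gg := grid_le n (ab_le j) (leqnSn i).
have := ltW (bt j); have := a0 j => aj bj.
split.
- exact: le_trans ag.
- exact: le_trans (le_trans gg gb) bj.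
- exact: le_trans (le_trans aj ag) gg.
- exact: le_trans gb bj.
Qed.

Lemma step_grid_crosses f x : counting_path f -> box a b x ->
  (forall s, 0 <= s <= t -> f s = step_path l x s) ->
  forall n, grid_crosses f n.
Proof.
move=> pf xab fx n; have xD := box_open_simplex xab.
have cell (j : 'I_r) : { i : 'I_(2 ^ n) |
    grid (a j) (b j) n i < tnth x j <= grid (a j) (b j) n i.+1}.
  by apply/cid/grid_cell; have := xab j; rewrite /= in_itv.
exists [ffun j => sval (cell j)]; split.
  by rewrite fx ?lexx ?ltW// (step_path_end _ _ xD).
move=> j; rewrite ffunE; case: (cell j) => i /= /andP[ix xi].
have [g0 gt g0' gt'] := grid_range j i.
split; rewrite fx ?g0 ?gt ?g0' ?gt'//.
  exact: (step_path_level_le _ t_gt0 xD ix).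
exact: (step_path_level_ge _ t_gt0 xD xi).
Qed.

(** The jump times are the passage times at the levels [j + 1]. As the crossing
    cells shrink to them, the path has not exceeded level [j] before the [j]-th one:
    the level is crossed in a single jump. *)
Lemma grid_crosses_step f : counting_path f -> (forall n, grid_crosses f n) ->
  exists2 x, box a b x & forall s, 0 <= s <= t -> f s = step_path l x s.
Proof.
move=> pf fgrid; have [f0 fnd _] := pf.
have [ft _] : f t = level r /\ True by have [I []] := fgrid 0%N.
have passage (j : 'I_r) : { s | 0 < s <= t /\
    forall u, 0 <= u -> ((u < s) -> (f u < level j.+1)%N) /\
                        ((s <= u) -> (level j.+1 <= f u)%N)}.
  apply/cid; have [s s0t sP] := @first_passage _ f (level j.+1) t pf
    (leq_ltn_trans (leq0n _) (level_ltS l_gt0 j)) (ltW t_gt0)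
    ltac:(by rewrite ft; exact: level_mono (ltn_ord j)).
  by exists s.
pose x := [tuple sval (passage j) | j < r].
have xE j : tnth x j = sval (passage j) by rewrite tnth_mktuple.
have x0t j : 0 < tnth x j <= t by rewrite xE; case: (passage j) => s [].
have xlt j u : 0 <= u -> u < tnth x j -> (f u < level j.+1)%N.
  by rewrite xE; case: (passage j) => s /= [_ sP] u0; have [] := sP u u0.
have xge j u : 0 <= u -> tnth x j <= u -> (level j.+1 <= f u)%N.
  by rewrite xE; case: (passage j) => s /= [_ sP] u0; have [] := sP u u0.
(* the crossing interval of the grid contains the passage time *)
have xcell n : exists I : {ffun 'I_r -> 'I_(2 ^ n)}, forall j,
    [/\ grid (a j) (b j) n (I j) < tnth x j,
        tnth x j <= grid (a j) (b j) n (I j).+1 &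
        (f (grid (a j) (b j) n (I j)) <= level j)%N].
  have [I [_ fI]] := fgrid n; exists I => j; have [flo fhi] := fI j.
  have [g0 gt g0' gt'] := grid_range j (I j); split=> //.
    rewrite ltNge; apply/negP => /(xge _ _ g0) /leq_trans/(_ flo).
    by rewrite leqNgt level_ltS.
  rewrite leNgt; apply/negP => /(xlt _ _ g0').
  by rewrite ltnNge fhi.
have xab : box a b x.
  move=> j; have [I /(_ j)[lox xhi _]] := xcell 0%N; rewrite /= in_itv/=.
  have [ag gb] := grid_itv (ab_le j) (ltn_ord (I j)).
  by rewrite (le_lt_trans ag)// (le_trans xhi).
exists x => //; apply: step_path_unique => //.
- exact: box_open_simplex.
- move=> j s /andP[s0 st] sx.
  have [n meshn] := grid_mesh (a j) (b j) (e := tnth x j - s) ltac:(by rewrite subr_gt0).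
  have [I /(_ j)[lox xhi flo]] := xcell n.
  apply: (leq_trans _ flo); apply: fnd => //.
  move: meshn; rewrite -(gridS _ _ _ (I j)) => meshn.
  lra.
- by move=> j s /andP[s0 _]; exact: xge.
Qed.

Lemma grid_crosses_decr f n : counting_path f ->
  grid_crosses f n.+1 -> grid_crosses f n.
Proof.
move=> [_ fnd _] [I [ft fI]].
have half (j : 'I_r) : ((I j)./2 < 2 ^ n)%N.
  by rewrite ltn_half_double -mul2n -expnS.
exists [ffun j => Ordinal (half j)]; split=> // j; rewrite ffunE/=.
have [flo fhi] := fI j.
have [g0 _ _ _] := grid_range j (Ordinal (half j)).
have [_ _ g0' _] := grid_range j (I j).
split.
  apply: leq_trans flo; apply: fnd => //.
  rewrite -grid_double; apply: grid_le => //.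
  by rewrite -[leqRHS]odd_double_half leq_addl.
apply: (leq_trans fhi); apply: fnd => //.
rewrite -[leRHS]grid_double; apply: grid_le => //.
by rewrite -[X in (X < _)%N]odd_double_half doubleS; case: (odd _).
Qed.

End boxes.

(** * Probability of crossing the levels in given intervals *)

Section crossing_law.
Context d (T : measurableType d) (R : realType) (P : probability T R).
Variables (lambda : R) (N : R -> {RV P >-> nat}).
Hypothesis lambda_gt0 : 0 < lambda.
Hypothesis HN : gamma_poisson_process lambda N.
Variables (r : nat) (l : 'I_r -> nat) (t : R).
Hypothesis l_gt0 : forall j, (1 <= l j)%N.
Hypothesis t_gt0 : 0 < t.
Implicit Types (s u : R).
Notation level := (level l).

Lemma counting_path_process w : counting_path (fun u => N u w).
Proof.
split; [exact: (gp_start HN)|move=> s u|move=> u u0].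
  exact: (gp_nondecreasing HN).
by have /discrete_cvg := @gp_right_continuous _ _ _ _ _ _ HN w u u0; exact.
Qed.

(** Along successive increments the exponential and geometric factors of the
    marginal laws telescope. *)
Lemma prod_marginal (u : nat -> R) (L : nat -> nat) m : u 0%N = 0 -> L 0%N = 0%N ->
  (forall i, u i <= u i.+1) -> (forall i, (L i <= L i.+1)%N) ->
  \prod_(i < m) marginal N (L i.+1 - L i) (u i.+1 - u i) =
  expR (- (total_intensity lambda * u m)) * (lambda / (1 + lambda)) ^+ L m *
  \prod_(i < m) rising_coef (L i.+1 - L i) (u i.+1 - u i).
Proof.
move=> u0 L0 uS LS; elim: m => [|m IHm].
  by rewrite !big_ord0 u0 L0 mulr0 oppr0 expR0 expr0 !mulr1.
rewrite !big_ord_recr/= IHm (marginalE lambda_gt0 HN) ?subr_ge0//.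
have -> : expR (- (total_intensity lambda * u m.+1)) =
    expR (- (total_intensity lambda * u m)) *
    expR (- (total_intensity lambda * (u m.+1 - u m))).
  by rewrite -expRD; congr expR; ring.
rewrite -[in X in _ = _ * X * _](subnKC (LS m)) exprD; ring.
Qed.

Variables lo hi : 'I_r -> R.
Hypotheses (lo_ge0 : forall j, 0 <= lo j) (lo_hi : forall j, lo j <= hi j)
  (hi_t : forall j, hi j <= t)
  (hi_lo : forall i j : 'I_r, (i < j)%N -> hi i <= lo j).

Let lo' m := oapp lo t (insub m).
Let hi' m := oapp hi t (insub m).

Let lo'E (j : 'I_r) : lo' j = lo j. Proof. by rewrite /lo' valK. Qed.
Let hi'E (j : 'I_r) : hi' j = hi j. Proof. by rewrite /hi' valK. Qed.
Let lo'_out m : (r <= m)%N -> lo' m = t.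
Proof. by move=> rm; rewrite /lo' insubF// ltnNge rm. Qed.
Let hi'_out m : (r <= m)%N -> hi' m = t.
Proof. by move=> rm; rewrite /hi' insubF// ltnNge rm. Qed.

(* the times 0, lo 0, hi 0, lo 1, hi 1, ..., t *)
Let time i : R :=
  if i is i'.+1 then (if odd i' then hi' i'./2 else lo' i'./2) else 0.

Let time_lo m : time m.*2.+1 = lo' m.
Proof. by rewrite /time odd_double doubleK. Qed.

Let time_hi m : time m.*2.+2 = hi' m.
Proof. by rewrite /time/= odd_double/= uphalf_double. Qed.

Let parity i : exists m, i = m.*2 \/ i = m.*2.+1.
Proof.
exists i./2; rewrite -{1 3}(odd_double_half i).
by case: (odd i); [right|left].
Qed.

Let timeS i : time i <= time i.+1.
Proof.
have [m [->|->]] := parity i; last first.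
  rewrite time_lo time_hi; have [mr|rm] := ltnP m r.
    by rewrite -[m]/(nat_of_ord (Ordinal mr)) lo'E hi'E.
  by rewrite lo'_out// hi'_out.
case: m => [|m].
  rewrite time_lo/=; have [r0|r0] := ltnP 0 r.
    by rewrite -[0%N]/(nat_of_ord (Ordinal r0)) lo'E.
  by rewrite lo'_out// ltW.
rewrite time_lo doubleS time_hi; have [mr|rm] := ltnP m.+1 r.
  rewrite -[m.+1]/(nat_of_ord (Ordinal mr)) lo'E.
  by rewrite -[m]/(nat_of_ord (Ordinal (ltnW mr))) hi'E hi_lo.
rewrite lo'_out//; have [mr|rm'] := ltnP m r.
  by rewrite -[m]/(nat_of_ord (Ordinal mr)) hi'E.
by rewrite hi'_out.
Qed.

Let time_ge0 i : 0 <= time i.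
Proof. by elim: i => // i IHi; exact: le_trans (timeS i). Qed.

Let time_end : time r.*2.+1 = t.
Proof. by rewrite time_lo lo'_out. Qed.

Let jump i := (level i.+1./2 - level i./2)%N.

Let half_le i : (level i./2 <= level i.+1./2)%N.
Proof. by apply: level_mono; rewrite half_leq. Qed.

(* Monotonicity forces the path to sit exactly at level j at time lo j and at
   level j + 1 at time hi j, so that all increments are prescribed: zero between
   hi j and lo (j + 1), and l j between lo j and hi j. *)
Let crosses_incrementsE : [set w | crosses l t (fun u => N u w) lo hi] =
  [set w | forall i, (i < r.*2.+1)%N ->
    increment N (time i) (time i.+1) w = jump i].
Proof.
apply/seteqP; split => w.
  have [N0 fnd _] := counting_path_process w.
  move=> [Nt Ncross].
  have Nlo (j : 'I_r) : N (lo j) w = level j.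
    apply/eqP; rewrite eqn_leq (Ncross j).1/=.
    case: j => -[|j] jr /=; first by rewrite level0.
    have := (Ncross (Ordinal (ltnW jr))).2; move/leq_trans; apply.
    apply: fnd; first exact: le_trans (lo_hi _).
    by apply: hi_lo => /=.
  have Nhi (j : 'I_r) : N (hi j) w = level j.+1.
    apply/eqP; rewrite eqn_leq (Ncross j).2 andbT.
    have [jr|rj] := ltnP j.+1 r.
      apply: leq_trans (Ncross (Ordinal jr)).1.
      by apply: fnd; [exact: le_trans (lo_hi _)|exact: hi_lo].
    have -> : j.+1 = r by apply/eqP; rewrite eqn_leq rj andbT.
    by rewrite -Nt; apply: fnd => //; exact: le_trans (lo_hi _).
  have Ntime i : (i <= r.*2.+1)%N -> N (time i) w = level i./2.
    have [m [->|->]] := parity i; last first.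
      rewrite ltnS leq_double time_lo /= uphalf_double => mr.
      move: mr; rewrite leq_eqVlt => /predU1P[->|mr]; first by rewrite lo'_out.
      by rewrite -[m]/(nat_of_ord (Ordinal mr)) lo'E Nlo.
    case: m => [_|m]; first by rewrite N0 level0.
    rewrite doubleS ltnS => mr; rewrite time_hi /= half_double.
    have {}mr : (m < r)%N by rewrite -ltn_double.
    by rewrite -[m]/(nat_of_ord (Ordinal mr)) hi'E Nhi.
  by move=> i ir; rewrite /increment (Ntime _ ir) (Ntime _ (ltnW ir)).
move=> Hinc; have [N0 fnd _] := counting_path_process w.
have Ntime i : (i <= r.*2.+1)%N -> N (time i) w = level i./2.
  elim: i => [_|i IHi ir]; first by rewrite N0 level0.
  have : increment N (time i) (time i.+1) w = jump i by exact: Hinc.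
  rewrite /increment => /(congr1 (addn^~ (N (time i) w))).
  have Nle : (N (time i) w <= N (time i.+1) w)%N := fnd _ _ (time_ge0 i) (timeS i).
  by rewrite (subnK Nle) => ->; rewrite (IHi (ltnW ir)) (subnK (half_le i)).
split; first by rewrite -{1}time_end Ntime// /= uphalf_double.
move=> j; rewrite -lo'E -hi'E -time_lo -time_hi !Ntime.
- by rewrite /= uphalf_double half_double.
- by rewrite ltnS ltn_double.
- by rewrite ltnS leq_double ltnW.
Qed.

Lemma measurable_crosses :
  measurable [set w | crosses l t (fun u => N u w) lo hi].
Proof.
rewrite crosses_incrementsE.
rewrite (_ : [set w | _] = \bigcap_(i in `I_(r.*2.+1))
   (increment N (time i) (time i.+1) @^-1` [set jump i])).
  apply: bigcap_measurable => [|i _]; first by exists 0%N.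
  exact: (measurable_increment N).
by apply/seteqP; split => w /= H i; exact: H.
Qed.

Lemma probability_crosses :
  P [set w | crosses l t (fun u => N u w) lo hi] =
  (expR (- (total_intensity lambda * t)) * (lambda / (1 + lambda)) ^+ (level r) *
   \prod_(j < r) rising_coef (l j) (hi j - lo j))%:E.
Proof.
rewrite crosses_incrementsE (probability_increments HN)//; congr EFin.
have pairs m : \prod_(i < m.*2.+1) rising_coef (jump i) (time i.+1 - time i) =
    \prod_(j < m) rising_coef (level j.+1 - level j) (hi' j - lo' j).
  elim: m => [|m IHm].
    by rewrite big_ord_recl !big_ord0 /jump/= subnn rising_coef0 mulr1.
  rewrite doubleS 2!big_ord_recr/= IHm big_ord_recr/= -time_hi -time_lo.
  by rewrite /jump /= !uphalf_double half_double subnn rising_coef0 mulr1 odd_double.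
have := prod_marginal (L := fun i => level i./2) r.*2.+1 (erefl : time 0 = 0)
  (level0 l) timeS half_le.
rewrite time_end [level r.*2.+1./2]/= uphalf_double.
move=> E; apply: (etrans E); congr (_ * _); apply: (etrans (pairs r)).
by apply: eq_bigr => j _; rewrite lo'E hi'E levelS addKn.
Qed.

End crossing_law.

(** * The law of the jump times on ordered boxes *)

Lemma cvg_prod_fintype (R : realType) (I : finType) (f : nat -> I -> R) (L : I -> R) :
  (forall i, f n i @[n --> \oo] --> L i) ->
  \prod_(i : I) f n i @[n --> \oo] --> \prod_(i : I) L i.
Proof.
move=> fL; rewrite /index_enum; elim: (Finite.enum _) => [|i s IHs].
  by rewrite big_nil; under eq_fun do rewrite big_nil; exact: cvg_cst.
rewrite big_cons; under eq_fun do rewrite big_cons.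
by apply: cvgM; [exact: fL|exact: IHs].
Qed.

Section box_law.
Context d (T : measurableType d) (R : realType) (P : probability T R).
Variables (lambda : R) (N : R -> {RV P >-> nat}).
Hypothesis lambda_gt0 : 0 < lambda.
Hypothesis HN : gamma_poisson_process lambda N.
Variables (r : nat) (l : 'I_r -> nat) (t : R).
Hypothesis l_gt0 : forall j, (1 <= l j)%N.
Hypothesis t_gt0 : 0 < t.

Definition step_event (A : set (r.-tuple R)) : set T :=
  [set w | exists2 x, A x & forall s, 0 <= s <= t -> N s w = step_path l x s].

(** The constant density of the jump times on the simplex. *)
Definition jump_density : R :=
  expR (- (total_intensity lambda * t)) *
  (lambda / (1 + lambda)) ^+ (level l r) * \prod_(j < r) (l j)%:R^-1.

Lemma jump_density_ge0 : 0 <= jump_density.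
Proof.
apply: mulr_ge0; last by apply: prodr_ge0 => j _; rewrite invr_ge0.
by rewrite mulr_ge0 ?expR_ge0// exprn_ge0// divr_ge0 ?addr_ge0// ltW.
Qed.

Section one_box.
Variables a b : 'I_r -> R.
Hypothesis ab_ordered : ordered_box t a b.
Hypothesis ab_le : forall j, a j <= b j.

Let lo n (I : {ffun 'I_r -> 'I_(2 ^ n)}) j := grid (a j) (b j) n (I j).
Let hi n (I : {ffun 'I_r -> 'I_(2 ^ n)}) j := grid (a j) (b j) n (I j).+1.
Let cell_event n I : set T :=
  [set w | crosses l t (fun u => N u w) (@lo n I) (@hi n I)].
Let grid_event n : set T := [set w | grid_crosses l t a b (fun u => N u w) n].

Let cells n (I : {ffun 'I_r -> 'I_(2 ^ n)}) :
  [/\ forall j, 0 <= lo I j, forall j, lo I j <= hi I j, forall j, hi I j <= t &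
      forall i j : 'I_r, (i < j)%N -> hi I i <= lo I j].
Proof.
have [a0 bt ba] := ab_ordered.
have g j := grid_itv (ab_le j) (ltn_ord (I j)).
split=> [j|j|j|i j ij].
- by apply: le_trans (g j).1.
- exact: grid_le.
- exact: le_trans (g j).2 (ltW (bt j)).
- exact: le_trans (g i).2 (le_trans (ba _ _ ij) (g j).1).
Qed.

Let grid_eventE n : grid_event n = \bigcup_I @cell_event n I.
Proof.
apply/seteqP; split => w; first by move=> [I HI]; exists I.
by move=> [I _ HI]; exists I.
Qed.

Let measurable_cell n I : measurable (@cell_event n I).
Proof. by have [? ? ? ?] := cells I; exact: (measurable_crosses HN). Qed.

Let measurable_grid_event n : measurable (grid_event n).
Proof.
rewrite grid_eventE; apply: fin_bigcup_measurable; first exact: finite_finset.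
by move=> I _; exact: measurable_cell.
Qed.

(* A path climbing from level j within a cell stays above level j afterwards, so
   it cannot do so again within a later cell. *)
Let trivIset_cells n : trivIset setT (@cell_event n).
Proof.
apply/trivIsetP => I I' _ _ II'; rewrite -subset0 => w [[_ HI] [_ HI']].
have [_ fnd _] := counting_path_process HN w.
apply: (negP II'); apply/eqP/ffunP => j; apply/val_inj/eqP.
have one_side (J J' : {ffun 'I_r -> 'I_(2 ^ n)}) :
    (level l j.+1 <= N (hi J j) w)%N -> (N (lo J' j) w <= level l j)%N ->
    (J' j <= J j)%N.
  move=> HJ HJ'; rewrite leqNgt; apply/negP => JJ'.
  have hl : hi J j <= lo J' j by exact: grid_le.
  have [lo0 lohi _ _] := cells J.
  have := leq_trans (leq_trans HJ (fnd _ _ (le_trans (lo0 j) (lohi j)) hl)) HJ'.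
  by rewrite leqNgt level_ltS.
rewrite eqn_leq (one_side I' I (HI' j).2 (HI j).1).
by rewrite (one_side I I' (HI j).2 (HI' j).1).
Qed.

Let probability_grid_event n : P (grid_event n) =
  (expR (- (total_intensity lambda * t)) *
   (lambda / (1 + lambda)) ^+ (level l r) *
   \prod_(j < r) ((2 ^ n)%:R * rising_coef (l j) ((b j - a j) / (2 ^ n)%:R)))%:E.
Proof.
rewrite grid_eventE measure_bigcup_fintype//; last exact: trivIset_cells.
rewrite (eq_bigr (fun=> (expR (- (total_intensity lambda * t)) *
   (lambda / (1 + lambda)) ^+ (level l r) *
   \prod_(j < r) (rising_coef (l j) ((b j - a j) / (2 ^ n)%:R)))%:E)).
  rewrite sumEFin big_const iter_addr_0 card_ffun !card_ord; congr EFin.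
  rewrite [in RHS]big_split/= big_const_ord iter_mulr_1 -[LHS]mulr_natl natrX.
  by rewrite mulrCA.
move=> I _; have [lo0 lohi hit hilo] := cells I.
apply: (etrans (probability_crosses lambda_gt0 HN l t_gt0 lo0 lohi hit hilo)).
by congr (_ * _)%:E; apply: eq_bigr => j _; rewrite /hi /lo gridS.
Qed.

Let cell_cvg j : (2 ^ n)%:R * rising_coef (l j) ((b j - a j) / (2 ^ n)%:R)
  @[n --> \oo] --> (b j - a j) * (l j)%:R^-1.
Proof.
have := l_gt0 j; case: (l j) => // m _.
have := ab_le j; rewrite -subr_ge0 le_eqVlt => /predU1P[<-|w0].
  rewrite mul0r; under eq_fun do rewrite mul0r rising_coef_at0 mulr0.
  exact: cvg_cst.
set w := b j - a j.
have h0 n : 0 < w / (2 ^ n)%:R by rewrite divr_gt0// ltr0n expn_gt0.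
have hcvg : w / (2 ^ n)%:R @[n --> \oo] --> (0 : R).
  rewrite -[X in _ --> X](mulr0 w); apply: cvgM; first exact: cvg_cst.
  apply: (@squeeze_cvgr _ _ _ _ (fun=> 0) (fun n => n.+1%:R^-1)).
  - near=> n; rewrite invr_ge0 ler0n/= lef_pV2 ?posrE ?ltr0n ?expn_gt0//.
    by rewrite ler_nat ltn_expl.
  - exact: cvg_cst.
  - exact: cvg_harmonic.
have /cvg_at_rightP rc := @rising_coef_cvg R m.
suff -> : (fun n => (2 ^ n)%:R * rising_coef m.+1 (w / (2 ^ n)%:R)) =
    (fun n => w * (rising_coef m.+1 (w / (2 ^ n)%:R) / (w / (2 ^ n)%:R))).
  by apply: cvgM; [exact: cvg_cst|exact: (rc _ (conj h0 hcvg))].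
apply/funext => n; have p0 : (2 ^ n)%:R != 0 :> R by rewrite pnatr_eq0 expn_eq0.
move: (rising_coef _ _) p0 => y; move: ((2 ^ n)%:R) => z z0.
by field; rewrite z0 gt_eqF.
Unshelve. all: by end_near. Qed.

Let step_eventE : step_event (box a b) = \bigcap_n grid_event n.
Proof.
apply/seteqP; split => w.
  move=> [x xab fx] n _.
  exact: (step_grid_crosses t_gt0 ab_ordered ab_le (counting_path_process HN w) xab fx).
move=> Hw.
have [x xab fx] := grid_crosses_step l_gt0 t_gt0 ab_ordered ab_le
  (counting_path_process HN w) (fun n => Hw n I).
by exists x.
Qed.

Lemma measurable_step_box : measurable (step_event (box a b)).
Proof. by rewrite step_eventE; exact: bigcap_measurable. Qed.

(** The approximating event has [2 ^ n] equally likely choices of a cell on each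
    side of length [w], and [2 ^ n * rising_coef l (w / 2 ^ n)] tends to [w / l]. *)
Lemma probability_step_box : P (step_event (box a b)) =
  (jump_density * \prod_(j < r) (b j - a j))%:E.
Proof.
have Pcvg : P (grid_event n) @[n --> \oo] --> P (step_event (box a b)).
  rewrite step_eventE; apply: nonincreasing_cvg_mu => //.
  - by rewrite (le_lt_trans (probability_le1 _ _))// ltry.
  - exact: bigcap_measurable.
  - apply/nonincreasing_seqP => n; apply/subsetPset => w.
    exact: grid_crosses_decr (counting_path_process HN w).
rewrite (funext probability_grid_event) in Pcvg.
apply: (cvg_unique _ Pcvg) => //; apply/cvg_EFin; first exact: nearW.
rewrite /jump_density -mulrA -big_split/=; apply: cvgM; first exact: cvg_cst.
apply: cvg_prod_fintype => j; rewrite [_^-1 * _]mulrC; exact: cell_cvg.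
Qed.

End one_box.
End box_law.

(** * The simplex as a countable union of ordered boxes *)

Section rational_boxes.
Context d (T : measurableType d) (R : realType) (P : probability T R).
Variables (lambda : R) (N : R -> {RV P >-> nat}).
Hypothesis lambda_gt0 : 0 < lambda.
Hypothesis HN : gamma_poisson_process lambda N.
Variables (r : nat) (l : 'I_r -> nat) (t : R).
Hypothesis l_gt0 : forall j, (1 <= l j)%N.
Hypothesis t_gt0 : 0 < t.
Notation simplex := (open_simplex r t).
Notation step_event := (step_event N l t).

Lemma measurable_box (a b : 'I_r -> R) : measurable (box a b).
Proof.
rewrite (_ : box a b = \bigcap_(j in [set: 'I_r])
    ((fun x : r.-tuple R => tnth x j) @^-1` `]a j, b j]%classic)).
  apply: fin_bigcap_measurable; first exact: finite_finset.
  move=> j _; rewrite -[X in measurable X]setTI.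
  exact: (@measurable_tnth _ R).
by apply/seteqP; split => x H j; [move=> _|]; exact: H.
Qed.

(** The sides of the box are the consecutive intervals cut out by the rationals
    [q_0 <= ... <= q_r]. *)
Definition rat_lo (q : r.+1.-tuple rat) (j : 'I_r) : R :=
  ratr (tnth q (widen_ord (leqnSn r) j)).
Definition rat_hi (q : r.+1.-tuple rat) (j : 'I_r) : R := ratr (tnth q (lift ord0 j)).
Definition rat_ordered q :=
  ordered_box t (rat_lo q) (rat_hi q) /\ forall j, rat_lo q j <= rat_hi q j.
Definition rat_box q : set (r.-tuple R) :=
  [set x | rat_ordered q /\ box (rat_lo q) (rat_hi q) x].

(** Rationals are chosen between consecutive terms of [0, x_1, ..., x_r, t]. *)
Lemma simplex_rat_box : simplex = \bigcup_q rat_box q.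
Proof.
apply/seteqP; split => x; last first.
  by move=> [q _ [[qo _]]]; exact: box_open_simplex.
move=> xD; have [x0t xs] := (open_simplexP t_gt0 x).1 xD.
(* the sequence 0, x_1, ..., x_r, t *)
pose y i := nth 0 (0 :: rcons x t) i.
have yx (j : 'I_r) : y j.+1 = tnth x j.
  by rewrite /y /= nth_rcons size_tuple ltn_ord (tnth_nth 0).
have yS (i : 'I_r.+1) : y i < y i.+1.
  by have /(pathP 0) := xD; apply; rewrite size_rcons size_tuple.
have ysorted : sorted <=%R (0 :: rcons x t).
  by apply: (sub_sorted (@ltW _ R)); exact: xD.
have ymono i j : (i <= j)%N -> (j <= r.+1)%N -> y i <= y j.
  move=> ij jr; apply: (sorted_leq_nth le_trans le_refl) => //;
    rewrite inE /= size_rcons size_tuple ltnS //; exact: leq_trans jr.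
have y_end : y r.+1 = t by rewrite /y /= nth_rcons size_tuple ltnn eqxx.
have qex (i : 'I_r.+1) : { q : rat | y i < ratr q < y i.+1 }.
  by apply: cid; have [q] := rat_in_itvoo (yS i); rewrite in_itv; exists q.
pose q := [tuple sval (qex i) | i < r.+1].
have qy (i : 'I_r.+1) : y i < ratr (tnth q i) < y i.+1.
  by rewrite tnth_mktuple; case: (qex i).
exists q => //.
have lo_x j : rat_lo q j < tnth x j.
  by have /andP[_] := qy (widen_ord (leqnSn r) j); rewrite yx.
have x_hi j : tnth x j < rat_hi q j.
  by have /andP[+ _] := qy (lift ord0 j); rewrite /= /bump add1n yx.
split; last by move=> j; rewrite /= in_itv/= lo_x ltW.
split; last by move=> j; rewrite ltW// (lt_trans (lo_x j)).
split=> [j|j|i j ij].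
- have /andP[/ltW h _] := qy (widen_ord (leqnSn r) j); apply: le_trans h.
  by apply: (ymono 0%N) => //=; rewrite ltnW// ltnS ltnW.
- have /andP[_ h] := qy (lift ord0 j); apply: (lt_le_trans h).
  by rewrite -y_end; apply: ymono.
rewrite /rat_hi /rat_lo; move: ij; rewrite leq_eqVlt => /predU1P[ij|ij].
  rewrite (_ : lift ord0 i = widen_ord (leqnSn r) j)//.
  by apply/val_inj; rewrite /= /bump add1n.
have /andP[_ /ltW h1] := qy (lift ord0 i).
have /andP[/ltW h2 _] := qy (widen_ord (leqnSn r) j).
apply: (le_trans h1); apply: le_trans h2; apply: ymono => /=.
  by rewrite /bump add1n.
by rewrite ltnW// ltnS ltnW.
Qed.

Lemma measurable_rat_box q : measurable (rat_box q).
Proof.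
have [qo|qno] := pselect (rat_ordered q).
  rewrite (_ : rat_box q = box (rat_lo q) (rat_hi q)); first exact: measurable_box.
  by apply/seteqP; split => x; [case|].
rewrite (_ : rat_box q = set0)//.
by apply/seteqP; split => x // [].
Qed.

Lemma measurable_simplex : measurable simplex.
Proof.
by rewrite simplex_rat_box; apply: countable_bigcupT_measurable => // q;
  exact: measurable_rat_box.
Qed.

Lemma measurable_step_simplex : measurable (step_event simplex).
Proof.
rewrite (_ : step_event simplex = \bigcup_q step_event (rat_box q)).
  apply: countable_bigcupT_measurable => // q.
  have [[qo qle]|qno] := pselect (rat_ordered q).
    rewrite (_ : step_event (rat_box q) = step_event (box (rat_lo q) (rat_hi q))).
      exact: (measurable_step_box HN).
    by apply/seteqP; split => w [x]; [move=> [_ xq]|move=> xq]; exists x.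
  rewrite (_ : step_event (rat_box q) = set0)//.
  by apply/seteqP; split => w // [x []].
apply/seteqP; split => w.
  by move=> [x]; rewrite simplex_rat_box => -[q _ xq]; exists q => //; exists x.
by move=> [q _ [x xq Nx]]; exists x => //; rewrite simplex_rat_box; exists q.
Qed.

End rational_boxes.

(** * The law of the jump times on the simplex *)

Section jump_times_density.
Context d (T : measurableType d) (R : realType) (P : probability T R).
Variables (lambda : R) (N : R -> {RV P >-> nat}).
Hypothesis lambda_gt0 : 0 < lambda.
Hypothesis HN : gamma_poisson_process lambda N.
Variables (r : nat) (l : 'I_r -> nat) (t : R).
Hypothesis l_gt0 : forall j, (1 <= l j)%N.
Hypothesis t_gt0 : 0 < t.
Notation simplex := (open_simplex r t).
Notation step_event := (step_event N l t).

(** Capping the passage time at level [j + 1] by [t] keeps the set nonempty, and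
    the infimum meaningful, on every path. *)
Definition passage_set (j : 'I_r) (w : T) : set R :=
  [set s | 0 <= s /\ ((level l j.+1 <= N s w)%N \/ t <= s)].

Definition passage_time w : r.-tuple R := [tuple inf (passage_set j w) | j < r].

Let has_inf_passage j w : has_inf (passage_set j w).
Proof.
split; last by exists 0 => s [].
by exists t; split; [exact: ltW|right].
Qed.

(** The passage time is less than [y] when the process exceeds the level at some
    rational time before [y]. *)
Lemma measurable_passage_time : measurable_fun setT passage_time.
Proof.
apply/measurable_fun_tnthP => j.
apply: (measurability _ (RGenInftyO.measurableE R)) => _ [_ [y ->] <-].
rewrite setTI (_ : _ @^-1` _ = \bigcup_(q : rat)
    [set w | 0 <= (ratr q : R) < y /\
      ((level l j.+1 <= N (ratr q) w)%N \/ t <= (ratr q : R))]).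
  apply: bigcupT_measurable_rat => q.
  have [q0|q0] := boolP (0 <= (ratr q : R) < y); last first.
    rewrite (_ : [set w | _] = set0)//.
    by apply/seteqP; split => w // [].
  have [tq|tq] := leP t (ratr q : R).
    rewrite (_ : [set w | _] = setT)//.
    by apply/seteqP; split => w // _; split=> //; right.
  rewrite (_ : [set w | _] = N (ratr q) @^-1` [set n | (level l j.+1 <= n)%N]).
    exact: (measurable_level N).
  apply/seteqP; split => w /=; last by move=> ?; split=> //; left.
  by move=> [_ []].
apply/seteqP; split => w; rewrite /= /passage_time tnth_mktuple in_itv/=.
  move=> infy; have [u [u0 uN] uy] := inf_lt (has_inf_passage j w).1 infy.
  have [q] := rat_in_itvoo uy; rewrite in_itv/= => /andP[uq qy].
  have [_ fnd _] := counting_path_process HN w.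
  exists q => //; split; first by rewrite (le_trans u0 (ltW uq)) qy.
  case: uN => [uN|tu]; [left|right].
    exact: leq_trans (fnd _ _ u0 (ltW uq)).
  exact: le_trans (ltW uq).
move=> [q _ [/andP[q0 qy] qN]]; apply: le_lt_trans qy.
by apply: (inf_lbound (has_inf_passage j w).2).
Qed.

Lemma passage_timeE w x : simplex x ->
  (forall s, 0 <= s <= t -> N s w = step_path l x s) -> passage_time w = x.
Proof.
move=> xD Nx; have [x0t xs] := (open_simplexP t_gt0 x).1 xD.
apply: eq_from_tnth => j; rewrite tnth_mktuple.
have /andP[xj0 xjt] := x0t j.
have xjS : passage_set j w (tnth x j).
  split; first exact: ltW.
  left; rewrite Nx ?(ltW xj0) ?(ltW xjt)//.
  exact: (step_path_level_ge _ t_gt0 xD).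
apply/eqP; rewrite eq_le (inf_lbound (has_inf_passage j w).2 xjS)/=.
apply: lb_le_inf; first by exists (tnth x j).
move=> s [s0 sN]; rewrite leNgt; apply/negP => sx.
have st : s < t by exact: lt_trans xjt.
case: sN => [|ts]; last by rewrite leNgt st in ts.
rewrite Nx ?s0 ?(ltW st)// => /leq_trans/(_ (step_path_level_le _ t_gt0 xD sx)).
by rewrite leqNgt level_ltS.
Qed.

(** The jump times being recovered from the path as passage times, the event is
    measurable in [A]. *)
Lemma step_eventI A : step_event (A `&` simplex) =
  passage_time @^-1` A `&` step_event simplex.
Proof.
apply/seteqP; split => w.
  by move=> [x [xA xD] Nx]; split; [rewrite /preimage/= (passage_timeE xD Nx)|exists x].
move=> [pA [x xD Nx]]; rewrite /preimage/= (passage_timeE xD Nx) in pA.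
by exists x.
Qed.

Lemma measurable_step_event A : measurable A -> A `<=` simplex ->
  measurable (step_event A).
Proof.
move=> mA /setIidl <-; rewrite step_eventI; apply: measurableI.
  by rewrite -[X in measurable X]setTI; exact: measurable_passage_time.
exact: (measurable_step_simplex HN).
Qed.

(** A pi-system generating the Borel sets. Sets are only constrained inside the
    simplex, so that it covers the whole space and contains every Borel set
    disjoint from the simplex. *)
Definition simplex_boxes : set (set (r.-tuple R)) :=
  [set X | measurable X /\ (X `&` simplex = set0 \/
    exists a b : 'I_r -> R, [/\ ordered_box t a b, forall j, a j <= b j &
      X `&` simplex = box a b])].

Lemma box_setI (a b a' b' : 'I_r -> R) : box a b `&` box a' b' =
  box (fun j => Num.max (a j) (a' j)) (fun j => Num.min (b j) (b' j)).
Proof.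
apply/seteqP; split => x.
  move=> [H H'] j; have := H j; have := H' j; rewrite /= !in_itv/=.
  by move=> /andP[? ?] /andP[? ?]; rewrite gt_max le_min; apply/andP; split; apply/andP.
move=> H; split => j; have := H j; rewrite /= !in_itv/= gt_max le_min;
  by move=> /andP[/andP[? ?] /andP[? ?]]; apply/andP.
Qed.

Lemma box_simplex_boxes X (a b : 'I_r -> R) : measurable X -> ordered_box t a b ->
  X `&` simplex = box a b -> simplex_boxes X.
Proof.
move=> mX ab_o XE; split=> //.
have [ab|/existsNP[j /negP]] := pselect (forall j, a j <= b j).
  by right; exists a, b.
rewrite -ltNge => ba; left; rewrite XE; apply/seteqP; split => x // /(_ j).
rewrite /= in_itv/= => /andP[ax xb].
by have := lt_le_trans (lt_trans ba ax) xb; rewrite ltxx.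
Qed.

Lemma simplex_boxes_setI : setI_closed simplex_boxes.
Proof.
move=> X Y [mX HX] [mY HY]; have mXY := measurableI _ _ mX mY.
have XYE : (X `&` Y) `&` simplex = (X `&` simplex) `&` (Y `&` simplex).
  by rewrite setIACA setIid.
case: HX => [X0|[a [b [[a0 bt ba] ab Xab]]]].
  by split=> //; left; rewrite XYE X0 set0I.
case: HY => [Y0|[a' [b' [[a0' bt' ba'] ab' Yab]]]].
  by split=> //; left; rewrite XYE Y0 setI0.
apply: (box_simplex_boxes mXY); last by rewrite XYE Xab Yab box_setI.
split=> [j|j|i j ij].
- by rewrite le_max a0.
- by rewrite gt_min bt.
- by rewrite ge_min !le_max ba.
Qed.

Let cover (n : nat) : set (r.-tuple R) :=
  if n is n'.+1 then
    (if unpickle n' is Some q then rat_box t q else set0)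
  else ~` simplex.

Let mD : measurable simplex := measurable_simplex t_gt0 (r:=r).

Let simplexC_boxes : simplex_boxes (~` simplex).
Proof. by split; [exact: measurableC|left; rewrite setICl]. Qed.

Let rat_box_boxes q : simplex_boxes (rat_box t q).
Proof.
have mq := measurable_rat_box t q.
have [qo|qno] := pselect (rat_ordered t q); last first.
  by split=> //; left; apply/seteqP; split => x // [[]].
apply: (box_simplex_boxes mq qo.1).
apply/seteqP; split => x; first by move=> [[]].
by move=> xq; split; [split|exact: (box_open_simplex t_gt0 qo.1 xq)].
Qed.

(** It suffices to generate the half-spaces [y < x_i]; inside each rational box
    such a half-space cuts out an ordered box again. *)
Lemma sigma_simplex_boxes A : measurable A -> <<s simplex_boxes >> A.
Proof.
pose id' := (fun x => x) : g_sigma_algebraType simplex_boxes -> r.-tuple R.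
suff mid : measurable_fun setT id' by move=> mA; have := mid measurableT A mA; rewrite setTI.
apply/measurable_fun_tnthP => i.
apply: (measurability _ (RGenOInfty.measurableE R)) => _ [_ [y ->] <-].
rewrite setTI.
set X := _ @^-1` _.
have mX : @measurable _ (r.-tuple R) X.
  rewrite /X -[X in measurable X]setTI.
  by apply: (measurable_tnth i) => //; exact: measurable_itv.
have -> : X = (X `&` ~` simplex) `|` \bigcup_q (X `&` rat_box t q).
  by rewrite -setI_bigcupr -simplex_rat_box// -setIUr setUC setUv setIT.
apply: measurableU.
  apply: sub_sigma_algebra; split; first exact: (measurableI _ _ mX (measurableC mD)).
  by left; rewrite -setIA setICl setI0.
apply: countable_bigcupT_measurable => // q; apply: sub_sigma_algebra.
have mXq := measurableI _ _ mX (measurable_rat_box t q).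
have [qo|qno] := pselect (rat_ordered t q); last first.
  by split=> //; left; apply/seteqP; split => x // [[_ []]].
have [[a0 bt ba] qle] := qo.
apply: (@box_simplex_boxes _ (fun j => if j == i then Num.max (rat_lo R q j) y else rat_lo R q j)
  (rat_hi R q) mXq).
  split=> // [j|j k jk].
    by case: ifP => _; rewrite ?le_max a0.
  by case: ifP => _; rewrite ?le_max ba.
apply/seteqP; split => x.
  move=> [[Xx [_ xq]] _] j; have := xq j; rewrite /= !in_itv/= => /andP[ax xb].
  case: eqP => [ji|_]; last by rewrite ax.
  by rewrite gt_max ax xb andbT ji; move: Xx; rewrite /X/= in_itv/= andbT.
move=> xq; have xq' : box (rat_lo R q) (rat_hi R q) x.
  move=> j; have := xq j; rewrite /= !in_itv/=; case: ifP => // _.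
  by rewrite gt_max => /andP[/andP[-> _] ->].
split; last exact: (box_open_simplex t_gt0 qo.1 xq').
split; last by split.
have := xq i; rewrite eqxx /= in_itv/= gt_max => /andP[/andP[_ yx] _].
by rewrite /X/= in_itv/= yx.
Qed.

Lemma lebesgue_tuple_box_prod (a b : 'I_r -> R) : (forall j, a j <= b j) ->
  lebesgue_tuple R r (box a b) = (\prod_(j < r) (b j - a j))%:E.
Proof.
move=> ab; rewrite (@lebesgue_tuple_box _ _ (fun j => `]a j, b j]%classic));
  last by move=> j; exact: measurable_itv.
rewrite -prodEFin; apply: eq_bigr => j _; rewrite lebesgue_measure_itv/= lte_fin.
case: ltP => [_|ba]; first by rewrite EFinB.
by rewrite (@le_anti _ _ (a j) (b j)) ?subrr// ab.
Qed.

(** Both sides, restricted to the simplex, are finite measures that agree on the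
    pi-system above. *)
Lemma probability_step_event A : measurable A -> A `<=` simplex ->
  P (step_event A) = ((jump_density lambda l t)%:E * lebesgue_tuple R r A)%E.
Proof.
have mS := measurable_step_simplex HN l_gt0 t_gt0.
pose m0 : {measure set T -> \bar R} := mrestr P mS.
pose m1 : {measure set (r.-tuple R) -> \bar R} :=
  measure_function_pushforward__canonical__measure_function_Measure m0
    measurable_passage_time.
pose c := NngNum (jump_density_ge0 lambda_gt0 l t).
pose m2 : {measure set (r.-tuple R) -> \bar R} :=
  mscale c (mrestr (lebesgue_tuple R r) mD).
have m1E X : m1 X = P (step_event (X `&` simplex)) by rewrite step_eventI.
have m2E X : m2 X = ((jump_density lambda l t)%:E * lebesgue_tuple R r (X `&` simplex))%E.
  by [].
have cover_boxes n : simplex_boxes (cover n).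
  case: n => [|n] /=; first exact: simplexC_boxes.
  by case: unpickle => [q|]; [exact: rat_box_boxes|split=> //; left; rewrite set0I].
have coverT : \bigcup_n cover n = setT.
  apply/seteqP; split => // x _.
  have [xD|xD] := pselect (simplex x); last by exists 0%N.
  move: xD; rewrite simplex_rat_box// => -[q _ xq].
  by exists (pickle q).+1 => //=; rewrite pickleK.
have step0 : step_event set0 = set0.
  by apply/seteqP; split => w // [].
have m12 X : simplex_boxes X -> m1 X = m2 X.
  move=> [mX [X0|[a [b [ab_o ab Xab]]]]]; rewrite m1E m2E.
    by rewrite X0 step0 !measure0 mule0.
  by rewrite Xab (probability_step_box lambda_gt0 HN)// lebesgue_tuple_box_prod.
have m1_fin n : (m1 (cover n) < +oo)%E.
  rewrite m1E (le_lt_trans (probability_le1 _ _)) ?ltry//.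
  apply: measurable_step_event; last exact: subIsetr.
  by apply: measurableI => //; exact: (cover_boxes n).1.
move=> mA AD.
have := g_sigma_algebra_measure_unique simplex_boxes (fun X HX => HX.1)
  cover cover_boxes coverT m1 m2 simplex_boxes_setI m12 m1_fin A (sigma_simplex_boxes mA).
by rewrite m1E m2E (setIidl AD).
Qed.

End jump_times_density.

(** * The conditional law *)

Section conditional_law.
Context d (T : measurableType d) (R : realType) (P : probability T R).
Variables (lambda : R) (N : R -> {RV P >-> nat}).
Hypothesis HN : gamma_poisson_process lambda N.
Variables (r : nat) (l : 'I_r -> nat) (t : R).
Hypothesis l_gt0 : forall j, (1 <= l j)%N.
Hypothesis t_gt0 : 0 < t.

Lemma jumps_eventE A : A `<=` open_simplex r t ->
  jumps_event N t l A = step_event N l t A.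
Proof.
move=> AD; apply/seteqP; split => w.
  move=> [x [_ xN lN xA]]; exists x => //.
  by apply/(jumps_stepP l_gt0 t_gt0 (counting_path_process HN w) (AD _ xA)).
move=> [x xA Nx]; exists x.
have /(jumps_stepP l_gt0 t_gt0 (counting_path_process HN w) (AD _ xA))[xN lN] := Nx.
by split=> //; exact: open_simplex_sorted (AD _ xA).
Qed.

Lemma step_event_sub A : A `<=` open_simplex r t ->
  step_event N l t A `<=` N t @^-1` [set (\sum_(j < r) l j)%N].
Proof.
move=> AD w [x /AD xD Nx]; rewrite /preimage/= Nx ?lexx ?ltW//.
by rewrite (step_path_end _ t_gt0 xD) level_size.
Qed.

(** The simplex is contained in the cube ]0, t]^r. *)
Lemma lebesgue_tuple_simplex_fin A : measurable A -> A `<=` open_simplex r t ->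
  lebesgue_tuple R r A \is a fin_num.
Proof.
move=> mA AD; rewrite ge0_fin_numE//.
apply: (@le_lt_trans _ _ (lebesgue_tuple R r (box (fun=> 0) (fun=> t)))).
  apply: le_measure; rewrite ?inE//; first exact: measurable_box.
  move=> x /AD/open_simplexP[//|x0t _] j.
  by have /andP[x0 xt] := x0t j; rewrite /= in_itv/= x0 ltW.
by rewrite lebesgue_tuple_box_prod ?ltry// => j; exact: ltW.
Qed.

End conditional_law.

Theorem mainTheorem12 (d : measure_display) (T : measurableType d)
    (R : realType) (P : probability T R) (lambda : R)
    (N : R -> {RV P >-> nat}) (k r : nat) (l : 'I_r -> nat) (t : R)
    (A : set (r.-tuple R)) :
  0 < lambda ->
  gamma_poisson_process lambda N ->
  (1 <= k)%N -> (1 <= r <= k)%N ->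
  (forall j, (1 <= l j)%N) -> (\sum_(j < r) l j)%N = k ->
  0 < t ->
  measurable A -> A `<=` open_simplex r t ->
  measurable (jumps_event N t l A) /\
  cond_prob P (jumps_event N t l A)
              (N t @^-1` [set k]) =
  \int[lebesgue_tuple R r]_(x in A)
    (k`!%:R * Gamma t / Gamma (t + k%:R) * \prod_(j < r) (l j)%:R^-1).
Proof.
move=> lambda0 HN _ _ l0 lk t0 mA AD.
rewrite (jumps_eventE HN)//.
split; first exact: (measurable_step_event HN).
rewrite /cond_prob setIidl; last by rewrite -lk; exact: step_event_sub.
rewrite (probability_step_event lambda0 HN)// Rintegral_cst//.
rewrite fineM//; last exact: lebesgue_tuple_simplex_fin AD.
rewrite -/(marginal N k t) (marginalE lambda0 HN) ?ltW//.
rewrite /= /jump_density level_size lk mulrAC; congr (_ * _).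
have Gt0 : Gamma t != 0 by rewrite gt_eqF// Gamma_gt0.
have GE : Gamma (t + k%:R) = rising_coef k t * k`!%:R * Gamma t.
  by rewrite Gamma_rising// divfK// pnatr_eq0 -lt0n fact_gt0.
have a0 : rising_coef k t != 0 by rewrite gt_eqF// rising_coef_gt0.
have k0 : k`!%:R != 0 :> R by rewrite pnatr_eq0 -lt0n fact_gt0.
have e0 : expR (- (total_intensity lambda * t)) != 0 by rewrite gt_eqF// expR_gt0.
have x0 : (lambda / (1 + lambda)) ^+ k != 0.
  by rewrite expf_neq0// gt_eqF// divr_gt0// addr_gt0.
rewrite GE; move: a0 k0 e0 x0.
move: (rising_coef _ _) (k`!%:R) (expR _) (_ ^+ k) (\prod_(_ < _) _) => a b c e f a0 b0 c0 e0.
by field; rewrite a0 b0 c0 e0 Gt0.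
Qed.
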